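(* Consider the completely random measure mixed Poisson model with mass $\gamma_0$ and jump measure $\rho$ described in the context. For $i\in\{1,\ldots,n\}$ let $\boldsymbol z^{-i}=\boldsymbol z\setminus z_i$, let $l^{-i}$ be the number of clusters in $\boldsymbol z^{-i}$ and $n_k^{-i}=\sum_{j\ne i}\mathbf 1(z_j=k)$. Then, conditionally on the sample size $n$ and on $\boldsymbol z^{-i}$, $$P(z_i=k\mid\boldsymbol z^{-i},n,\gamma_0,\rho)\propto\begin{cases}\dfrac{\int_0^\infty s^{n_k^{-i}+1}e^{-s}\rho(ds)}{\int_0^\infty s^{n_k^{-i}}e^{-s}\rho(ds)}, & k=1,\ldots,l^{-i};\\[2mm] \gamma_0\int_0^\infty se^{-s}\rho(ds), & k=l^{-i}+1,\end{cases}$$ where the proportionality constant does not depend on $k$.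
   Context: Setting: $\Omega$ is a complete separable metric space, $G_0$ a finite measure on $\Omega$ with $\gamma_0=G_0(\Omega)>0$, and $\rho$ a nonzero measure on $(0,\infty)$ with $\int_0^\infty(1-e^{-s})\rho(ds)<\infty$. $G=\sum_k r_k\delta_{\omega_k}$ is the completely random measure whose points $(r_k,\omega_k)$ are those of a Poisson random measure on $(0,\infty)\times\Omega$ with intensity $\rho(ds)G_0(d\omega)$. Given $G$, the sample size satisfies $n\sim\mathrm{Po}(G(\Omega))$, and given $G$ and $n$, each of the $n$ elements is independently assigned to atom $\omega_k$ with probability $r_k/G(\Omega)$. Elements assigned to the same atom form a cluster, giving a random partition of $\{1,\ldots,n\}$; $\boldsymbol z=(z_1,\ldots,z_n)$ are the cluster labels. In the claim, the clusters of the partition restricted to $\{1,\ldots,n\}\setminus\{i\}$ are labelled $1,\ldots,l^{-i}$ (any labelling determined by $\boldsymbol z^{-i}$); $z_i=k\le l^{-i}$ means element $i$ belongs to the existing cluster $k$, and $z_i=l^{-i}+1$ means element $i$ forms a new singleton cluster. All probabilities are with $G$ integrated out. *)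

(* Defs.v *)
From HB Require Import structures.
From mathcomp Require Import all_boot all_order all_algebra.
From mathcomp Require Import all_classical all_reals all_analysis.
From mathcomp Require Import measurable_realfun.

Set Implicit Arguments.
Unset Strict Implicit.
Unset Printing Implicit Defensive.

Import Order.TTheory GRing.Theory Num.Theory.
Import numFieldNormedType.Exports.

Local Open Scope classical_set_scope.
Local Open Scope ring_scope.

#[short(type="completeMetricType")]
HB.structure Definition CompleteMetric (R : numDomainType) :=
  {M of Complete M & Metric R M}.

Definition separable (M : topologicalType) : Prop :=
  exists2 S : set M, countable S & dense S.

Notation borelType M := (g_sigma_algebraType (@open M)).

(* Agrees with the library's [poisson_pmf] for a positive rate; at rate 0, where
   [poisson_pmf] is constantly 1, it is the mass function of the Dirac law at 0. *)
Definition poisson_weight {R : realType} (rate : R) (m : nat) : R :=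
  rate ^+ m / m`!%:R * expR (- rate).

Section probability.
Context {d : measure_display} {T : measurableType d} {R : realType}.
Variable P : probability T R.

Definition cond_prob (A B : set T) : R := fine (P (A `&` B)) / fine (P B).

(* [f] is a version of the conditional probability of [A] given the sigma-algebra
   generated by [H]. *)
Definition is_cond_prob (H : set (set T)) (A : set T) (f : T -> R) : Prop :=
  measurable_fun setT (f : g_sigma_algebraType H -> R) /\
  forall E, <<s H >> E -> P (A `&` E) = (\int[P]_(t in E) (f t)%:E)%E.

Definition mutually_independent (m : nat) (X : 'I_m -> T -> \bar R) : Prop :=
  forall B : 'I_m -> set (\bar R), (forall j, measurable (B j)) ->
  P (\bigcap_(j in [set: 'I_m]) (X j @^-1` B j)) =
  (\prod_(j < m) P (X j @^-1` B j))%E.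

(* The Poisson law with parameter [+oo] is the Dirac mass at [+oo]. *)
Definition has_poisson_law (X : T -> \bar R) (lam : \bar R) : Prop :=
  if lam == +oo%E then P [set t | X t = +oo%E] = 1%E
  else forall m : nat,
    P [set t | X t = m%:R%:E] = (poisson_weight (fine lam) m)%:E.

Definition is_poisson_random_measure {d' : measure_display}
    {E : measurableType d'} (D : set E) (N : T -> set E -> \bar R)
    (mu : set E -> \bar R) : Prop :=
  (forall A, measurable A -> A `<=` D -> has_poisson_law (N ^~ A) (mu A)) /\
  (forall (m : nat) (A : 'I_m -> set E),
     (forall j, measurable (A j) /\ A j `<=` D) -> trivIset setT A ->
     mutually_independent (fun j => N ^~ (A j))).

End probability.

Section model.
Context {d : measure_display} {T : measurableType d} {R : realType}.
Variable P : probability T R.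
Variable Om : completeMetricType R.
Variables (r : nat -> {RV P >-> R}) (w : nat -> {RV P >-> borelType Om}).
Variables (n : {RV P >-> nat}) (c : nat -> {RV P >-> nat}).

(* The points of the Poisson process are the [(r k, w k)] with [0 < r k];
   indices [k] with [r k = 0] are padding, as there may be finitely many points. *)
Definition crm_point (k : nat) (t : T) : (R * borelType Om)%type := (r k t, w k t).

Definition point_measure (t : T) (A : set (R * borelType Om)%type) : \bar R :=
  (\sum_(k <oo) \d_(crm_point k t) A)%E.

Definition crm (t : T) (A : set (borelType Om)) : \bar R :=
  (\sum_(k <oo) (r k t)%:E * \d_(w k t) A)%E.

(* In the model below, [crm t setT] is almost surely finite. *)
Definition total_mass (t : T) : R := fine (crm t setT).

(* Generators of the sigma-algebras used to condition on the random measure, and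
   on the random measure together with the sample size. *)
Definition gens_G : set (set T) :=
  \bigcup_k preimage_set_system setT (crm_point k) measurable.

Definition gens_Gn : set (set T) :=
  gens_G `|` preimage_set_system setT n measurable.

(* [n] is the sample size and [c j] the index of the atom to which element [j]
   is assigned; only the [c j] with [j < n] are constrained. Atoms with different
   indices count as different, even if [G0] has atoms and their locations agree. *)
Record crm_mixed_poisson (rho : {measure set R -> \bar R})
    (G0 : {finite_measure set (borelType Om) -> \bar R}) : Prop := {
  jump_ge0 : forall k t, 0 <= r k t ;
  points_poisson : is_poisson_random_measure P
    [set p : R * borelType Om | 0 < p.1] point_measure (rho \x G0)%E ;
  size_poisson : forall m : nat,
    is_cond_prob P gens_G [set t | n t = m]
      (fun t => poisson_weight (total_mass t) m) ;
  assignment : forall (m : nat) (a : 'I_m -> nat),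
    is_cond_prob P gens_Gn [set t | n t = m /\ forall j : 'I_m, c j t = a j]
      (fun t => \1_[set u | n u = m] t *
                \prod_(j < m) (r (a j) t / total_mass t)) }.

End model.

Section labels.
Variables (n : nat) (lab : {set {set 'I_n}} -> seq {set 'I_n}).

Definition is_labelling : Prop := forall Q, perm_eq (lab Q) (enum Q).

(* Labels start at 1: the clusters of the partition of [[set~ i]] induced by [f]
   are numbered in the order prescribed by [lab]. The label of [j] is the number
   of the cluster whose elements share the [f]-value of [j], and it is the number
   of clusters plus one if there is none, which can happen only for [j = i]. *)
Definition cluster_label (i : 'I_n) (f : 'I_n -> nat) (j : 'I_n) : nat :=
  (find (fun B : {set 'I_n} => [exists j' in B, f j' == f j])
        (lab (preim_partition f [set~ i]))).+1.

Definition num_clusters (i : 'I_n) (zeta : 'I_n -> nat) : nat :=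
  size (undup [seq zeta j | j <- enum 'I_n & j != i]).

Definition cluster_size (i : 'I_n) (zeta : 'I_n -> nat) (k : nat) : nat :=
  (\sum_(j < n | j != i) (zeta j == k))%N.

End labels.

Definition tilted_moment {R : realType} (rho : {measure set R -> \bar R})
    (m : nat) : R :=
  \int[rho]_(s in `]0, +oo[) (s ^+ m * expR (- s)).

(* Main.v *)
Require Import Defs.
From HB Require Import structures.
From mathcomp Require Import all_boot all_order all_algebra.
From mathcomp Require Import all_classical all_reals all_analysis.
From mathcomp Require Import measurable_realfun.
From mathcomp Require Import ring.

Set Implicit Arguments.
Unset Strict Implicit.
Unset Printing Implicit Defensive.

Import Order.TTheory GRing.Theory Num.Theory.
Import numFieldNormedType.Exports.

Local Open Scope classical_set_scope.
Local Open Scope ring_scope.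

(** Only the jumps [r k] matter: counting them in Borel subsets of [(0, +oo)]
  gives a Poisson random measure with intensity [nu = gamma0 * rho]. Let
  [S = \sum_k r_k]. The factor [S^n / n! * e^-S] of the sample size cancels the
  normalisations [r_k / S], so an assignment [a] has probability
  [1/n! * E[\prod_j r_(a j) * e^-S]], and summing over the assignments that
  induce a given partition with block sizes [n_1, ..., n_l] gives
  [1/n! * E[\sum_(k_1, ..., k_l distinct) \prod_b r_(k_b)^(n_b) * e^-S]].
  By a Mecke-type formula this equals
  [1/n! * \prod_b (gamma0 * \int s^(n_b) e^-s rho(ds)) * E[e^-S]],
  and the theorem follows by comparing the partitions extending that of the
  other elements. The Mecke-type formula is proved for all weights
  [exp (- \sum_k g (r_k))] at once, by induction on the number [l] of indices:
  the case [l = 0] is the Laplace functional, and the step differentiates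
  [g + e * s^m] at [e = 0]. *)

(** * Nonnegative integrals and independence *)

(** The hypotheses describe only the counts of the [r k], not the joint law of the enumeration
    itself, hence the route through the Laplace functional. The induction closes because the same
    surplus appears on both sides. On the left, the index of the new factor [\sum_k r_k^n] may
    coincide with one already present, which raises that exponent by [n]. On the right, the product
    rule raises the order of one moment by [n]. These terms involve no additional index, so the
    induction hypothesis identifies them and they cancel. What remains is the term with a new index
    on the left, and on the right the factor obtained by differentiating the Laplace exponent. The
    power sums may be infinite and have no integrable bound at hand. The derivative is therefore
    taken along [e = 2^-p], where the difference quotients increase and monotone convergence
    applies. The cancellation takes place between real numbers because every moment that occurs has
    positive order, and those are finite. *)

Section nonneg_integral.
Import HBNNSimple.
Local Open Scope ereal_scope.

(** Multiplication is discontinuous at [0 * +oo]. Monotonicity removes the bad case: if the limit is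
    0, then [v] is identically 0. *)
Lemma ge0_nd_cvgeMl (R : realType) (c l : \bar R) (v : nat -> \bar R) :
  (forall p, 0 <= v p) -> {homo v : m n / (m <= n)%N >-> m <= n} ->
  v p @[p --> \oo] --> l -> c * v p @[p --> \oo] --> c * l.
Proof.
move=> v0 ndv vl.
have vlel p : v p <= l.
  rewrite -(cvg_lim _ vl)//; apply: lime_ge; first by apply/cvg_ex; exists l.
  by near=> q; apply: ndv; near: q; exists p.
have [l0|l0] := eqVneq l 0.
  have -> : (fun p => c * v p) = cst 0.
    apply/funext => p; suff -> : v p = 0 by rewrite mule0.
    by apply/eqP; rewrite eq_le v0 -l0 vlel.
  by rewrite l0 mule0; exact: cvg_cst.
have [->|cn0] := eqVneq c 0.
  under eq_fun do rewrite mul0e.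
  by rewrite mul0e; exact: cvg_cst.
apply: cvgeM => //; first by rewrite mule_defE (negbTE cn0) (negbTE l0).
exact: cvg_cst.
Unshelve. all: by end_near. Qed.

Lemma ge0_integral_indic_mul d (T : measurableType d)
    (R : realType) (mu : {measure set T -> \bar R}) (A : set T) (u : T -> \bar R) :
  \int[mu]_x (u x * (\1_A x)%:E) = \int[mu]_(x in A) u x.
Proof.
rewrite [RHS]integral_mkcond; apply: eq_integral => x _.
by rewrite patchE indicE; case: (x \in A); rewrite ?mule1 ?mule0.
Qed.

(** [u] and [v] have the same conditional expectation given [X], so they are interchangeable against
    any function of [X]. It serves with [v] constant, for independence, and with [X] the identity
    into a coarser sigma-algebra, for conditional probabilities. *)
Lemma eq_ge0_integral_mul_comp d d1 (T : measurableType d)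
    (T1 : measurableType d1) (R : realType) (mu : {measure set T -> \bar R})
    (X : T -> T1) (u v : T -> \bar R) (phi : T1 -> \bar R) :
  measurable_fun setT X ->
  measurable_fun setT u -> (forall x, 0 <= u x) ->
  measurable_fun setT v -> (forall x, 0 <= v x) ->
  measurable_fun setT phi -> (forall x, 0 <= phi x) ->
  (forall B, measurable B ->
    \int[mu]_(x in X @^-1` B) u x = \int[mu]_(x in X @^-1` B) v x) ->
  \int[mu]_x (u x * phi (X x)) = \int[mu]_x (v x * phi (X x)).
Proof.
move=> mX mu_ u0 mv_ v0 mphi phi0 uv.
pose h := nnsfun_approx measurableT mphi.
have limE w : (forall x, 0 <= w x) -> measurable_fun setT w ->
    \int[mu]_x (w x * (h p (X x))%:E) @[p --> \oo] -->
    \int[mu]_x (w x * phi (X x)).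
  move=> w0 mw.
  have ndh x : {homo (fun p => (h p (X x))%:E) : m n / (m <= n)%N >-> m <= n}.
    move=> m n mn; rewrite lee_fin.
    by move/lefP: (nd_nnsfun_approx measurableT mphi mn); exact.
  have -> : \int[mu]_x (w x * phi (X x)) =
      \int[mu]_x (limn (fun p => w x * (h p (X x))%:E)).
    apply: eq_integral => x _; apply/esym/cvg_lim => //.
    apply: ge0_nd_cvgeMl => //.
    - by move=> p; rewrite lee_fin.
    - exact: (@cvg_nnsfun_approx _ _ _ _ measurableT _ mphi).
  apply: cvg_monotone_convergence => //.
  - move=> p; apply: emeasurable_funM => //.
    by apply/measurable_EFinP; apply: measurableT_comp => //.
  - by move=> p x _; rewrite mule_ge0// lee_fin.
  - by move=> x _ m n mn; rewrite lee_wpmul2l// ndh.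
suff E p : \int[mu]_x (u x * (h p (X x))%:E) = \int[mu]_x (v x * (h p (X x))%:E).
  have Lu := limE _ u0 mu_; have := limE _ v0 mv_.
  by under eq_fun do rewrite -E; move/(cvg_lim (@ereal_hausdorff R)) <-;
     rewrite (cvg_lim (@ereal_hausdorff R) Lu).
pose s := finmap.enum_fset (fset_set (range (h p))).
pose A y := X @^-1` (h p @^-1` [set y]).
have mA y : measurable (A y).
  by rewrite -[A y]setTI; apply: mX => //; exact: measurable_funPTI.
have hA x y : 0 <= (y * \1_(A y) x)%:E :> \bar R.
  rewrite lee_fin indicE; have [|] := boolP (x \in A y); last by rewrite mulr0.
  by rewrite inE mulr1 /A /= => <-.
have E w : (forall x, 0 <= w x) -> measurable_fun setT w ->
    \int[mu]_x (w x * (h p (X x))%:E) =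
    \sum_(y <- s) \int[mu]_x (w x * (y * \1_(A y) x)%:E).
  move=> w0 mw; rewrite -ge0_integral_sum//.
  - apply: eq_integral => x _.
    rewrite {1}(fimfunE (h p) (X x)) fsbig_finite//= -sumEFin ge0_sume_distrr//.
    by move=> y _; exact: (hA x y).
  - move=> y; apply: emeasurable_funM => //; apply/measurable_EFinP.
    by apply: measurable_funM => //; exact: measurable_indic.
  - by move=> y x _; rewrite mule_ge0.
rewrite !E//; apply: eq_bigr => y _.
(* For negative [y] the nonnegative quantity in [hA] is also nonpositive, so both sides vanish. *)
have [y0|y0] := leP 0%R y; last first.
  apply: eq_integral => x _; suff -> : (y * \1_(A y) x)%R = 0%R by rewrite !mule0.
  apply/eqP; rewrite eq_le -!lee_fin hA andbT lee_fin.
  by rewrite mulr_le0_ge0// ltW.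
have Z w : (forall x, 0 <= w x) -> measurable_fun setT w ->
    \int[mu]_x (w x * (y * \1_(A y) x)%:E) = y%:E * \int[mu]_(x in A y) w x.
  move=> w0 mw; rewrite -(ge0_integral_indic_mul _ (A y)) -ge0_integralZl//.
  - by apply: eq_integral => x _; rewrite EFinM muleCA.
  - apply: emeasurable_funM => //; apply/measurable_EFinP.
    exact: measurable_indic.
  - by move=> x _; rewrite mule_ge0// lee_fin.
by rewrite !Z// uv//; exact: measurable_funPTI.
Qed.

End nonneg_integral.

Lemma emeasurable_prod d (T : measurableType d) (R : realType) (D : set T)
    (I : Type) (s : seq I) (Q : pred I) (f : I -> T -> \bar R) :
  (forall i, measurable_fun D (f i)) ->
  measurable_fun D (fun t => \prod_(i <- s | Q i) f i t)%E.
Proof.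
move=> mf; elim: s => [|i s ih].
  by under eq_fun do rewrite big_nil; exact: measurable_cst.
under eq_fun do rewrite big_cons.
by case: (Q i) => //; exact: emeasurable_funM.
Qed.

(** The indicators of the definition of independence are replaced by the [phi j] one coordinate at a
    time: in [F p] the first [p] are done. The sets [B j] stay arbitrary, which is what permits the
    next replacement. *)
Lemma integral_prod_independent d (T : measurableType d) (R : realType)
    (P : probability T R) (m : nat) (X : 'I_m -> T -> \bar R)
    (phi : 'I_m -> \bar R -> \bar R) :
  (forall j, measurable_fun setT (X j)) -> mutually_independent P X ->
  (forall j, measurable_fun setT (phi j)) -> (forall j x, 0 <= phi j x)%E ->
  (\int[P]_t \prod_(j < m) phi j (X j t) =
   \prod_(j < m) \int[P]_t phi j (X j t))%E.
Proof.
move=> mX indX mphi phi0.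
pose F p (B : 'I_m -> set (\bar R)) (j : 'I_m) (t : T) : \bar R :=
  if (j < p)%N then phi j (X j t) else (\1_(X j @^-1` B j) t)%:E.
have mXB j (C : set (\bar R)) : measurable C -> measurable (X j @^-1` C).
  by move=> mC; rewrite -[X in measurable X]setTI; exact: mX.
have mF p B j : (forall j, measurable (B j)) -> measurable_fun setT (F p B j).
  move=> mB; rewrite /F; case: (j < p)%N; first exact: measurableT_comp.
  by apply/measurable_EFinP; apply: measurable_indic; exact: mXB.
have F0 p B j t : (0 <= F p B j t)%E.
  by rewrite /F; case: ifP => _; rewrite ?lee_fin.
suff H p B : (forall j, measurable (B j)) -> (p <= m)%N ->
    (\int[P]_t \prod_(j < m) F p B j t = \prod_(j < m) \int[P]_t F p B j t)%E.
  have Fm j : F m (fun=> setT) j = phi j \o X j.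
    by apply/funext => t; rewrite /F ltn_ord.
  transitivity (\int[P]_t \prod_(j < m) F m (fun=> setT) j t)%E.
    by apply: eq_integral => t _; apply: eq_bigr => j _; rewrite Fm.
  by rewrite H//; apply: eq_bigr => j _; rewrite Fm.
elim: p B => [|p ih] B mB pm.
  rewrite /F /=; transitivity (\prod_(j < m) P (X j @^-1` B j))%E; last first.
    by apply: eq_bigr => j _; rewrite integral_indic ?setIT//; exact: mXB.
  rewrite -indX// -[in RHS](setIT (\bigcap_(j in _) _)).
  rewrite -integral_indic//; last first.
    apply: fin_bigcap_measurable => [|j _]; [exact: finite_finset|exact: mXB].
  apply: eq_integral => t _; rewrite prodEFin; congr EFin.
  rewrite indicE; have [|] := boolP (t \in _).
    rewrite inE => /= tB; apply: big1 => j _.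
    by rewrite indicE mem_set//; exact: tB.
  rewrite notin_setE /= => /existsNP[j /not_implyP[_ tB]].
  by rewrite (bigD1 j)//= indicE memNset// mul0r.
pose j0 := Ordinal pm.
have FS C j : j != j0 -> F p.+1 B j = F p (fun j => if j == j0 then C else B j) j.
  move=> jj0; rewrite /F (negbTE jj0) ltnS leq_eqVlt.
  by rewrite (_ : (j == p :> nat) = false)//; apply/negbTE.
have Fj0 : F p.+1 B j0 = phi j0 \o X j0 by rewrite /F /= ltnS leqnn.
have FCj0 C : F p (fun j => if j == j0 then C else B j) j0 =
    fun t => (\1_(X j0 @^-1` C) t)%:E by rewrite /F /= ltnn eqxx.
pose u t := (\prod_(j < m | j != j0) F p.+1 B j t)%E.
pose v : \bar R := (\prod_(j < m | j != j0) \int[P]_t F p.+1 B j t)%E.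
have u0 t : (0 <= u t)%E by apply: prode_ge0 => j _; exact: F0.
have v0 : (0 <= v)%E by apply: prode_ge0 => j _; apply: integral_ge0 => t _.
have mu_ : measurable_fun setT u by apply: emeasurable_prod => j; exact: mF.
(* The induction hypothesis with [C] in place of [B j0] says that the product of the other factors
   has the constant [v] as conditional expectation given [X j0]. *)
have key C : measurable C ->
    (\int[P]_(t in X j0 @^-1` C) u t = \int[P]_(t in X j0 @^-1` C) cst v t)%E.
  move=> mC.
  have mB' j : measurable (if j == j0 then C else B j) by case: (j == j0).
  have := ih _ mB' (ltnW pm); rewrite [RHS](bigD1 j0)//= FCj0.
  under eq_integral do rewrite (bigD1 j0)//= muleC FCj0.
  rewrite integral_indic//; last exact: mXB.
  rewrite setIT integral_cst//; last exact: mXB.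
  rewrite ge0_integral_indic_mul muleC.
  under eq_integral do under eq_bigr => j jj0 do rewrite -(FS C j jj0).
  by under eq_bigr => j jj0 do rewrite -(FS C j jj0).
rewrite [RHS](bigD1 j0)//= -/v Fj0.
under eq_integral do rewrite (bigD1 j0)//= muleC Fj0 /= -/(u _).
have /= -> := eq_ge0_integral_mul_comp (mX j0) mu_ u0 (measurable_cst v)
  (fun=> v0) (mphi j0) (phi0 j0) key.
rewrite ge0_integralZl//; [by rewrite muleC|].
exact: (measurableT_comp (mphi j0) (mX j0)).
Qed.

(** * Laplace functional of a Poisson random measure *)

Section exponential.
Local Open Scope ereal_scope.
Variable R : realType.

Lemma measurable_expeR : measurable_fun setT (@expeR R).
Proof.
have -> : @expeR R = fun x => if x == +oo then +oo else
    if x == -oo then 0 else (expR (fine x))%:E.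
  by apply/funext => -[x| |].
apply: measurable_fun_ifT => //; first exact: measurable_fun_eqe.
apply: measurable_fun_ifT => //; first exact: measurable_fun_eqe.
by apply/measurable_EFinP; exact: measurableT_comp.
Qed.

Lemma measurable_expeRN d (T : measurableType d) (f : T -> \bar R) :
  measurable_fun setT f -> measurable_fun setT (fun t => expeR (- f t)).
Proof.
move=> mf; apply: (measurableT_comp measurable_expeR).
exact: (measurableT_comp _ mf).
Qed.

Lemma expeRN_le1 (x : \bar R) : 0 <= x -> expeR (- x) <= 1.
Proof. by move=> x0; rewrite -expeR0 lee_expeR oppe_le0. Qed.

Lemma expeRN_fin_num (x : \bar R) : 0 <= x -> expeR (- x) \is a fin_num.
Proof.
by move=> x0; rewrite ge0_fin_numE ?expeR_ge0// (le_lt_trans (expeRN_le1 x0))// ltry.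
Qed.

(** The limit may be [+oo], where the exponential is 0. Monotonicity ensures that all terms are
    finite when the limit is. *)
Lemma cvg_expeRN (u : nat -> \bar R) (l : \bar R) :
  (forall p, 0 <= u p) -> {homo u : m n / (m <= n)%N >-> m <= n} ->
  u p @[p --> \oo] --> l -> expeR (- u p) @[p --> \oo] --> expeR (- l).
Proof.
move=> u0 ndu ul.
have ulel p : u p <= l.
  rewrite -(cvg_lim _ ul)//; apply: lime_ge; first by apply/cvg_ex; exists l.
  by near=> q; apply: ndu; near: q; exists p.
case: l ul ulel => [l| |] ul ulel; last by have := ulel 0%N; rewrite leNgt (lt_le_trans _ (u0 0%N)).
- have uE p : u p = (fine (u p))%:E.
    by rewrite fineK// ge0_fin_numE// (le_lt_trans (ulel p))// ltry.
  have -> : (fun p => expeR (- u p)) = EFin \o (fun p => expR (- fine (u p))).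
    by apply/funext => p; rewrite [in LHS]uE.
  apply: cvg_EFin; first by near=> p.
  apply: (@continuous_cvg _ _ _ _ _ _ expR); first exact: continuous_expR.
  by apply: cvgN; apply: fine_cvg.
- rewrite /=; apply/fine_cvgP; split.
    by near=> p; exact: expeRN_fin_num.
  apply/cvgrPdist_le => e e0; near=> p.
  have : (- ln e)%:E <= u p.
    by near: p; move/cvgeyPge: ul; exact.
  rewrite /= sub0r normrN ger0_norm ?fine_ge0 ?expeR_ge0//.
  case: (u p) (u0 p) => [x| |]//= _; rewrite ?lee_fin => xe; last exact: ltW.
  by rewrite -[leRHS]lnK ?posrE// ler_expR lerNl.
Unshelve. all: by end_near. Qed.

Lemma nneseries_exp_coeff (x : R) :
  \sum_(m <oo) (x ^+ m / m`!%:R)%:E = (expR x)%:E.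
Proof.
rewrite /expR -EFin_lim; last exact: is_cvg_series_exp_coeff.
by congr (limn _); apply/funext => n; rewrite /= /series /= -sumEFin.
Qed.

(** For finite [lam] this sums the exponential series. For [lam = +oo] both sides are 0, which
    requires [x] positive because [0 * +oo = 0]. *)
Lemma poisson_expectation_expeR d (T : measurableType d) (P : probability T R)
    (X : T -> \bar R) (lam : \bar R) (x : R) :
  measurable_fun setT X -> has_poisson_law P X lam -> 0 <= lam ->
  (0 < x)%R ->
  \int[P]_t expeR (- (x%:E * X t)) = expeR (- (lam * (1 - expR (- x))%:E)).
Proof.
move=> mX + lam0 x0; rewrite /has_poisson_law.
have mf : measurable_fun setT (fun t => expeR (- (x%:E * X t))).
  by apply: measurable_expeRN; exact: measurable_funeM.
have mXe (y : \bar R) : measurable [set t | X t = y].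
  by have := mX measurableT [set y]; rewrite setTI; apply; exact: emeasurable_set1.
have f0 t : 0 <= expeR (- (x%:E * X t)) by exact: expeR_ge0.
have x1 : (0 < 1 - expR (- x))%R by rewrite subr_gt0 -expR0 ltr_expR oppr_lt0.
have full D : measurable D -> P D = 1 ->
    \int[P]_t expeR (- (x%:E * X t)) = \int[P]_(t in D) expeR (- (x%:E * X t)).
  move=> mD PD; rewrite (@ge0_negligible_integral _ _ _ _ _ (~` D))//.
  - by rewrite setDE setCK setTI.
  - exact: measurableC.
  - by rewrite [LHS]probability_setC// PD subee.
case: ifPn => [/eqP ->|lamoo Plam].
  move=> /(full _ (mXe _)) ->.
  transitivity (\int[P]_(t in [set t | X t = +oo]) cst 0 t).
    by apply: eq_integral => t /set_mem Xt; rewrite (Xt : X t = _) gt0_muley ?lte_fin.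
  by rewrite integral0 gt0_mulye ?lte_fin.
have {lamoo} lamE : lam = (fine lam)%:E.
  by rewrite fineK// ge0_fin_numE// lt_neqAle lamoo leey.
set l := fine lam in Plam lamE *; rewrite lamE.
pose D (m : nat) := [set t | X t = m%:R%:E].
have tD : trivIset setT D.
  apply/trivIsetP => i j _ _ ij; apply/seteqP; split=> // t [+ Xj].
  by rewrite /D /= (Xj : X t = _) => -[] /eqP; rewrite eqr_nat eq_sym (negbTE ij).
have Psum (y : R) : \sum_(m <oo) (expR (- (y * m%:R)))%:E * P (D m) =
    expeR (- (l * (1 - expR (- y)))%:E).
  transitivity (\sum_(m <oo) (expR (- l))%:E *
      ((l * expR (- y)) ^+ m / m`!%:R)%:E).
    apply: eq_eseriesr => m _; rewrite Plam /poisson_weight -!EFinM; congr EFin.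
    by rewrite exprMn -expRM_natr mulNr; ring.
  rewrite nneseriesZl; last first.
    move=> m _; rewrite lee_fin divr_ge0// exprn_ge0// mulr_ge0// ?expR_ge0//.
    by rewrite /l fine_ge0.
  by rewrite nneseries_exp_coeff -EFinM -expRD /=; congr (expR _)%:E; ring.
have mD : measurable (\bigcup_m D m) by apply: bigcupT_measurable => m; exact: mXe.
(* [has_poisson_law] only gives the masses of the integers; [Psum] at [y = 0] shows that they add up
   to 1, so the integral lives on the [D m]. *)
rewrite (full (\bigcup_m D m))//; last first.
  rewrite measure_bigcup//=; last by move=> m _; exact: mXe.
  have e0 : expR (- 0) = 1%R :> R by rewrite oppr0 expR0.
  transitivity (expeR (- (l * (1 - expR (- 0)))%:E)); last first.
    by congr EFin; rewrite e0 subrr mulr0.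
  rewrite -Psum.
  under eq_eseriesl do rewrite in_setT.
  by apply: eq_eseriesr => m _; rewrite mul0r e0 mul1e.
rewrite ge0_integral_bigcup//; last 2 first.
- by move=> m; exact: mXe.
- exact: measurable_funTS.
rewrite -EFinM -Psum; apply: eq_eseriesr => m _.
rewrite -integral_cst; last exact: mXe.
by apply: eq_integral => t /set_mem Xt; rewrite (Xt : X t = _).
Qed.

End exponential.

Section laplace_functional.
Import HBNNSimple.
Local Open Scope ereal_scope.

Lemma expeRN_sum (R : realType) (I : Type) (s : seq I) (f : I -> \bar R) :
  (forall i, 0 <= f i) ->
  expeR (- \sum_(i <- s) f i) = \prod_(i <- s) expeR (- f i).
Proof.
move=> f0; elim: s => [|i s ih]; first by rewrite !big_nil oppe0 expeR0.
rewrite !big_cons oppeD ?expeRD ?ih// ge0_adde_def// inE//.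
exact: sume_ge0.
Qed.

(** Only positive values are kept, the value 0 being absorbed by [phi 0 = 0]. The quantifier over
    [phi] yields at once the decompositions of [h] and of [1 - exp (- h)] over the same level
    sets. *)
Lemma nnsfun_decomp d (U : measurableType d) (R : realType)
    (h : {nnsfun U >-> R}) :
  exists (m : nat) (y : 'I_m -> R), [/\ injective y, forall j, (0 < y j)%R &
    forall (phi : R -> R) s, phi 0%R = 0%R ->
    phi (h s) = (\sum_(j < m) phi (y j) * \1_(h @^-1` [set y j]) s)%R].
Proof.
pose ys := [seq y <- finmap.enum_fset (fset_set (range h)) | (0 < y)%R].
have uys : uniq ys by rewrite filter_uniq// finmap.fset_uniq.
exists (size ys), (fun j => ys`_j); split.
- by move=> i j /eqP; rewrite nth_uniq// => /eqP /val_inj.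
- by move=> j; have := mem_nth 0%R (ltn_ord j); rewrite mem_filter => /andP[].
move=> phi s phi0.
have -> : (\sum_(j < size ys) phi ys`_j * \1_(h @^-1` [set ys`_j]) s =
    \sum_(y <- ys) phi y * \1_(h @^-1` [set y]) s)%R.
  by rewrite (big_nth 0%R) big_mkord.
have [hs0|hs0] := eqVneq (h s) 0%R.
  rewrite hs0 phi0 big_seq big1// => y; rewrite mem_filter => /andP[y0 _].
  rewrite indicE memNset ?mulr0//= hs0 => y0'.
  by move: y0; rewrite -y0' ltxx.
have hys : h s \in ys.
  rewrite mem_filter lt_neqAle eq_sym hs0 /=; apply/andP; split => //.
  by rewrite in_fset_set// inE; exists s.
rewrite (bigD1_seq (h s))//= indicE mem_set// mulr1 big1 ?addr0// => y yh.
by rewrite indicE memNset ?mulr0//= => /eqP; rewrite eq_sym (negbTE yh).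
Qed.

Context d (T : measurableType d) (R : realType).
Variables (P : probability T R) (x : nat -> T -> R).
Variable nu : {measure set R -> \bar R}.
Hypothesis mx : forall k, measurable_fun setT (x k).
Hypothesis x0 : forall k t, (0 <= x k t)%R.

Let count (B : set R) (t : T) : \bar R := \sum_(k <oo) (\1_B (x k t))%:E.

Hypothesis count_poisson : forall B : set R, measurable B -> B `<=` `]0%R, +oo[ ->
  has_poisson_law P (count B) (nu B).
Hypothesis count_independent : forall m (A : 'I_m -> set R),
  (forall j, measurable (A j) /\ A j `<=` `]0%R, +oo[) -> trivIset setT A ->
  mutually_independent P (fun j => count (A j)).

Let psum (h : R -> R) (t : T) : \bar R := \sum_(k <oo) (h (x k t))%:E.

Lemma measurable_psum (h : R -> R) :
  measurable_fun setT h -> (forall s, 0 <= s -> 0 <= h s)%R ->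
  measurable_fun setT (psum h).
Proof.
move=> mh h0; apply: (@ge0_emeasurable_sum _ _ _ _ _ xpredT).
  by move=> k t _ _; rewrite lee_fin h0.
by move=> k _; apply/measurable_EFinP; exact: measurableT_comp.
Qed.

(** Over the disjoint level sets [A j], [psum h] is the combination of independent Poisson counts
    with coefficients [y j], so the expectation is a product of Poisson transforms. *)
Lemma laplace_functional_nnsfun (h : {nnsfun R >-> R}) :
  (forall s, s <= 0 -> h s = 0)%R ->
  \int[P]_t expeR (- psum h t) =
  expeR (- \int[nu]_(s in `]0%R, +oo[) (1 - expR (- h s))%:E).
Proof.
move=> h00; have [m [y [injy y0 hE]]] := nnsfun_decomp h.
pose A j := h @^-1` [set y j].
have mA j : measurable (A j) by exact: measurable_funPTI.
have A0 j : A j `<=` `]0%R, +oo[.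
  move=> s /= hs; rewrite in_itv/= andbT ltNge; apply/negP => /h00 hs0.
  by have := y0 j; rewrite -hs hs0 ltxx.
have tA : trivIset setT A.
  apply/trivIsetP => i j _ _ ij; apply/seteqP; split => // s [hi hj].
  by move: ij; rewrite (injy i j) ?eqxx// -(hi : h s = _) -(hj : h s = _).
have mcount j : measurable_fun setT (count (A j)).
  by apply: measurable_psum => // s.
have count0 B t : 0 <= count B t by apply: nneseries_ge0 => k _ _; rewrite lee_fin.
transitivity (\int[P]_t \prod_(j < m) expeR (- ((y j)%:E * count (A j) t))).
  apply: eq_integral => t _; rewrite -expeRN_sum; last first.
    by move=> j; rewrite mule_ge0// lee_fin ltW.
  congr (expeR (- _)); rewrite /psum.
  have hE1 s : h s = (\sum_(j < m) y j * \1_(A j) s)%R := hE idfun s erefl.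
  under eq_eseriesr do rewrite hE1 -sumEFin.
  rewrite nneseries_sum; last first.
    by move=> j k _; rewrite lee_fin mulr_ge0// ltW.
  apply: eq_bigr => j _.
  under eq_eseriesr do rewrite EFinM.
  by rewrite nneseriesZl// => k _; rewrite lee_fin.
rewrite (integral_prod_independent (phi := fun j z => expeR (- ((y j)%:E * z))))//; last 3 first.
- exact: count_independent.
- by move=> j; apply: measurable_expeRN; exact: measurable_funeM.
- by move=> j z; exact: expeR_ge0.
under eq_bigr => j _ do rewrite (poisson_expectation_expeR (mcount j)
  (count_poisson (mA j) (A0 j)) (measure_ge0 _ _) (y0 j)).
have y1 j : (0 <= 1 - expR (- y j))%R.
  by rewrite subr_ge0 -expR0 ler_expR oppr_le0 ltW.
rewrite -expeRN_sum; last by move=> j; rewrite mule_ge0// lee_fin.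
congr (expeR (- _)).
under [RHS]eq_integral do rewrite (hE (fun z => 1 - expR (- z))%R) ?oppr0 ?expR0 ?subrr// -sumEFin.
rewrite ge0_integral_sum//; first last.
- by move=> j s _; rewrite lee_fin mulr_ge0.
- by move=> j; apply/measurable_EFinP; apply: measurable_funM => //.
apply: eq_bigr => j _; under eq_integral do rewrite EFinM.
rewrite ge0_integralZl_EFin//; last first.
  by apply/measurable_EFinP; exact: measurable_indic.
by rewrite integral_indic// (setIidl (A0 j)) muleC.
Qed.

Lemma laplace_functional (h : R -> R) : measurable_fun setT h ->
  (forall s, 0 <= s -> 0 <= h s)%R -> h 0%R = 0%R ->
  \int[P]_t expeR (- psum h t) =
  expeR (- \int[nu]_(s in `]0%R, +oo[) (1 - expR (- h s))%:E).
Proof.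
move=> mh h0 h00.
(* [h] is controlled on [[0, +oo[] only; [f] agrees with it there and vanishes on the negative
   half-line, so it can be approximated from below by simple functions. *)
pose f (s : R) : \bar R := (Num.max (h (Num.max s 0)) 0)%:E.
have fE s : (0 <= s)%R -> f s = (h s)%:E.
  by move=> s0; rewrite /f (max_idPl s0) (max_idPl (h0 _ s0)).
have f0 s : 0 <= f s by rewrite lee_fin le_max lexx orbT.
have fneg s : (s <= 0)%R -> f s = 0.
  by move=> s0; rewrite /f (max_idPr s0) h00 maxxx.
have mf : measurable_fun setT f.
  apply/measurable_EFinP; apply: measurable_maxr => //.
  apply: measurableT_comp => //; exact: measurable_maxr.
pose hp := nnsfun_approx measurableT mf.
have ndhp s : {homo (fun p => (hp p s)%:E) : m n / (m <= n)%N >-> m <= n}.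
  move=> m n mn; rewrite lee_fin.
  by move/lefP: (nd_nnsfun_approx measurableT mf mn); exact.
have cvghp s : (hp p s)%:E @[p --> \oo] --> f s.
  exact: (@cvg_nnsfun_approx _ _ _ _ measurableT _ mf).
have hpf p s : (hp p s)%:E <= f s.
  rewrite -(cvg_lim _ (cvghp s))//; apply: lime_ge; first by apply/cvg_ex; exists (f s).
  by near=> q; apply: ndhp; near: q; exists p.
have hp0 p s : (s <= 0)%R -> hp p s = 0%R.
  move=> s0; apply/eqP; rewrite eq_le -lee_fin (le_trans (hpf p s)) ?fneg//=.
have psum_cvg t : psum (hp p) t @[p --> \oo] --> psum h t.
  (* The series become integrals for the counting measure, to which monotone convergence applies. *)
  have E (g : R -> R) : (forall k, 0 <= g (x k t))%R ->
      psum g t = \int[counting]_k (g (x k t))%:E.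
    by move=> g0; rewrite ge0_integral_count.
  rewrite E; last by move=> k; exact: h0.
  rewrite (_ : (fun p => psum (hp p) t) =
      fun p => \int[counting]_k (hp p (x k t))%:E); last first.
    by apply/funext => p; exact: E.
  rewrite (_ : (fun k => (h (x k t))%:E) = fun k => limn (fun p => (hp p (x k t))%:E)).
    by apply: cvg_monotone_convergence => // p k _; rewrite lee_fin.
  by apply/funext => k; rewrite -fE//; apply/esym/cvg_lim.
have ndpsum t : {homo (fun p => psum (hp p) t) : m n / (m <= n)%N >-> m <= n}.
  move=> m n mn; apply: lee_nneseries => [k _ _|k _]; last exact: ndhp.
  by rewrite lee_fin.
have psum0 p t : 0 <= psum (hp p) t by apply: nneseries_ge0 => k _ _; rewrite lee_fin.
(* On the probability side the integrands decrease and are bounded by 1; on the side of [nu] they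
   increase. *)
have L : \int[P]_t expeR (- psum (hp p) t) @[p --> \oo] -->
    \int[P]_t expeR (- psum h t).
  apply: (@dominated_cvg _ _ _ P setT _ _ _ (cst 1)) => //.
  - by move=> p; apply: measurable_expeRN; exact: measurable_psum.
  - by move=> t _; apply: cvg_expeRN.
  - exact: finite_measure_integrable_cst.
  - by move=> p t _; rewrite gee0_abs ?expeR_ge0// expeRN_le1.
have Rt : expeR (- \int[nu]_(s in `]0%R, +oo[) (1 - expR (- hp p s))%:E) @[p --> \oo] -->
    expeR (- \int[nu]_(s in `]0%R, +oo[) (1 - expR (- h s))%:E).
  have nd s : {homo (fun p => (1 - expR (- hp p s))%:E) : m n / (m <= n)%N >-> m <= n}.
    by move=> m n mn; rewrite lee_fin lerD2l lerN2 ler_expR lerN2 -lee_fin; exact: ndhp.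
  have e0 p s : 0 <= (1 - expR (- hp p s))%:E.
    by rewrite lee_fin subr_ge0 -expR0 ler_expR oppr_le0.
  have me p : measurable_fun (`]0%R, +oo[%classic : set R) (fun s : R => (1 - expR (- hp p s))%:E).
    apply/measurable_EFinP; apply: measurable_funB => //.
    by apply: measurable_funTS; apply: measurableT_comp => //; exact: measurableT_comp.
  apply: cvg_expeRN.
  - by move=> p; apply: integral_ge0.
  - by move=> m n mn; apply: ge0_le_integral => // s _; exact: nd.
  rewrite (_ : \int[nu]_(s in `]0%R, +oo[) (1 - expR (- h s))%:E =
      \int[nu]_(s in `]0%R, +oo[) limn (fun p => (1 - expR (- hp p s))%:E)).
    by apply: cvg_monotone_convergence => // s _; exact: nd.
  apply: eq_integral => s; rewrite inE/= in_itv/= andbT => s0.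
  apply/esym/cvg_lim => //; apply: cvg_EFin; first by near=> p.
  apply: cvgB; first exact: cvg_cst.
  apply: (@continuous_cvg _ _ _ _ _ _ expR); first exact: continuous_expR.
  apply: cvgN; have := cvghp s; rewrite fE ?ltW//.
  by move/fine_cvg.
have {L} := cvg_lim (@ereal_hausdorff R) L => <-.
have {Rt} := cvg_lim (@ereal_hausdorff R) Rt => <-.
congr (limn _); apply/funext => p; apply: laplace_functional_nnsfun.
exact: hp0.
Unshelve. all: by end_near. Qed.

End laplace_functional.

(** * Sums over distinct indices *)

Section distinct_power_sum.
Local Open Scope ereal_scope.
Variable R : realType.
Implicit Types (x : nat -> R) (ns ex : seq nat).

Lemma ge0_nneseriesZl (c : \bar R) (f : nat -> \bar R) : (forall k, 0 <= f k) ->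
  c * \sum_(k <oo) f k = \sum_(k <oo) (c * f k).
Proof.
move=> f0; apply/esym/cvg_lim => //.
under eq_fun do rewrite -ge0_sume_distrr//.
apply: ge0_nd_cvgeMl.
- by move=> p; exact: sume_ge0.
- by move=> m n mn; exact: lee_sum_nneg_natr.
- by apply: is_cvg_nneseries => k _ _.
Qed.

Lemma nneseries_delta (a : nat -> R) (e : nat) : (forall k, 0 <= a k)%R ->
  \sum_(k <oo) ((k == e)%:R * a k)%:E = (a e)%:E.
Proof.
move=> a0; rewrite (@nneseriesD1 _ _ e)//=; last first.
  by move=> k _; rewrite lee_fin mulr_ge0.
rewrite eqxx mul1r (_ : \sum_(_ <oo | _) _ = 0) ?adde0//.
by apply: eseries0 => k _ /negbTE ->; rewrite mul0r.
Qed.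

Lemma nneseries_mem (a : nat -> R) ex : uniq ex -> (forall k, 0 <= a k)%R ->
  \sum_(k <oo) (a k)%:E =
  \sum_(k <oo) ((k \notin ex)%:R * a k)%:E + \sum_(e <- ex) (a e)%:E.
Proof.
move=> uex a0.
under [X in _ = _ + X]eq_bigr do rewrite -nneseries_delta//.
rewrite -nneseries_sum; last by move=> e k _; rewrite lee_fin mulr_ge0.
rewrite -nneseriesD; last 2 first.
- by move=> k _ _; rewrite lee_fin mulr_ge0.
- by move=> k _ _; apply: sume_ge0 => e _; rewrite lee_fin mulr_ge0.
apply: eq_eseriesr => k _; rewrite sumEFin -EFinD -mulr_suml -mulrDl.
rewrite -natr_sum -natrD -[in LHS](mul1r (a k)); congr (_ * _)%:E.
have -> : (\sum_(e <- ex) (k == e) = (k \in ex))%N.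
  under eq_bigr do rewrite eq_sym.
  by rewrite -(count_uniq_mem _ uex) -sum1_count [RHS]big_mkcond.
by case: (k \in ex).
Qed.

(* Sum over the tuples of pairwise distinct indices, avoiding [ex], of the
   products of the [ns]-powers. *)
Fixpoint dsum x ns ex : \bar R :=
  if ns is n :: ns' then
    \sum_(k <oo) ((k \notin ex)%:R * x k ^+ n)%:E * dsum x ns' (rcons ex k)
  else 1.

(** The exponent lists that arise when a factor of power [n] falls on an index already in use: one
    entry grows by [n], and the length is unchanged. *)
Fixpoint bumps (n : nat) ns : seq (seq nat) :=
  if ns is m :: ns' then ((m + n)%N :: ns') :: [seq m :: l | l <- bumps n ns']
  else [::].

Lemma dsum_ge0 x ns ex : (forall k, 0 <= x k)%R -> 0 <= dsum x ns ex.
Proof.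
move=> x0; elim: ns ex => [|n ns ih] ex //=.
apply: nneseries_ge0 => k _ _.
by rewrite mule_ge0// lee_fin mulr_ge0// exprn_ge0.
Qed.

(** The index of the extra power sum is either fresh, or in the excluded list [ex], or equal to one
    of the summed indices. The middle sum is empty for [ex = [::]], but the induction needs it since
    each summed index joins [ex]. *)
Lemma dsumM x ns ex n : (forall k, 0 <= x k)%R -> uniq ex ->
  dsum x ns ex * \sum_(k <oo) (x k ^+ n)%:E =
  dsum x (rcons ns n) ex + \sum_(e <- ex) (x e ^+ n)%:E * dsum x ns ex +
  \sum_(l <- bumps n ns) dsum x l ex.
Proof.
move=> x0; elim: ns ex => [|m ns ih] ex uex.
  rewrite /= big_nil adde0 mul1e.
  under [X in X + _]eq_eseriesr do rewrite mule1.
  under [X in _ + X]eq_bigr do rewrite mule1.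
  by rewrite -nneseries_mem// => k; rewrite exprn_ge0.
pose c k := ((k \notin ex)%:R * x k ^+ m)%:E.
have c0 k : 0 <= c k by rewrite lee_fin mulr_ge0// exprn_ge0.
have xn0 k j : 0 <= (x k ^+ j)%:E by rewrite lee_fin exprn_ge0.
have d0 l k : 0 <= dsum x l (rcons ex k) by exact: dsum_ge0.
rewrite [LHS]muleC ge0_nneseriesZl; last first.
  by move=> k; exact: mule_ge0 (c0 k) (d0 ns k).
transitivity (\sum_(k <oo) (c k * dsum x (rcons ns n) (rcons ex k) +
   \sum_(e <- ex) (x e ^+ n)%:E * (c k * dsum x ns (rcons ex k)) +
   ((k \notin ex)%:R * x k ^+ (m + n))%:E * dsum x ns (rcons ex k) +
   \sum_(l <- bumps n ns) c k * dsum x l (rcons ex k))).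
  apply: eq_eseriesr => k _; rewrite muleCA -/(c k).
  have -> : ((k \notin ex)%:R * x k ^+ (m + n))%:E * dsum x ns (rcons ex k) =
      c k * ((x k ^+ n)%:E * dsum x ns (rcons ex k)).
    by rewrite muleA /c -EFinM exprD mulrA.
  have [kex|kex] := boolP (k \in ex).
    rewrite /c kex /= !mul0r !mul0e !add0e.
    rewrite !big1 ?adde0// => e _; rewrite ?mul0e ?mule0//.
  have uexk : uniq (rcons ex k) by rewrite rcons_uniq kex.
  rewrite [X in c k * X = _]muleC ih// -(cats1 ex k) big_cat big_seq1 cats1 /=.
  have sx0 : 0 <= \sum_(e <- ex) (x e ^+ n)%:E * dsum x ns (rcons ex k).
    by apply: sume_ge0 => e _; rewrite mule_ge0.
  rewrite ge0_muleDr; last 2 first.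
  - by rewrite !adde_ge0 ?mule_ge0.
  - exact: sume_ge0.
  rewrite ge0_muleDr; last 2 first.
  - exact: d0.
  - by rewrite !adde_ge0 ?mule_ge0.
  rewrite ge0_muleDr; last 2 first.
  - exact: sx0.
  - exact: mule_ge0.
  rewrite ge0_sume_distrr; last by move=> e _; exact: mule_ge0.
  rewrite ge0_sume_distrr//.
  under eq_bigr do rewrite muleCA.
  by rewrite !addeA.
rewrite nneseriesD; last 2 first.
- move=> k _ _; rewrite !adde_ge0 ?mule_ge0//.
  + by rewrite sume_ge0// => e _; rewrite !mule_ge0.
  + by rewrite lee_fin mulr_ge0// exprn_ge0.
- by move=> k _ _; rewrite sume_ge0// => l _; exact: mule_ge0.
rewrite nneseriesD; last 2 first.
- move=> k _ _; rewrite !adde_ge0 ?mule_ge0//.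
  by rewrite sume_ge0// => e _; rewrite !mule_ge0.
- by move=> k _ _; rewrite mule_ge0// lee_fin mulr_ge0// exprn_ge0.
rewrite nneseriesD; last 2 first.
- by move=> k _ _; rewrite mule_ge0.
- by move=> k _ _; rewrite sume_ge0// => e _; rewrite !mule_ge0.
rewrite nneseries_sum; last by move=> e k _; rewrite !mule_ge0.
rewrite nneseries_sum; last by move=> l k _; rewrite mule_ge0.
rewrite /= big_cons big_map /= -!addeA; congr (_ + (_ + _)).
by apply: eq_bigr => e _; rewrite -ge0_nneseriesZl// => k; exact: mule_ge0.
Qed.

Lemma measurable_dsum d (T : measurableType d) (f : nat -> T -> R) ns ex :
  (forall k, measurable_fun setT (f k)) -> (forall k t, 0 <= f k t)%R ->
  measurable_fun setT (fun t => dsum (f ^~ t) ns ex).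
Proof.
move=> mf f0; elim: ns ex => [|n ns ih] ex; first exact: measurable_cst.
apply: (@ge0_emeasurable_sum _ _ _ _ _ xpredT).
  move=> k t _ _; rewrite mule_ge0 ?dsum_ge0// lee_fin mulr_ge0//.
  by rewrite exprn_ge0.
move=> k _; apply: emeasurable_funM => //; apply/measurable_EFinP.
by apply: measurable_funM => //; exact: measurable_funX.
Qed.

End distinct_power_sum.

(** * Difference quotients along the powers of 1/2 *)

Section halving_difference_quotient.
Variable R : realType.

(** Along these steps, monotonicity of a difference quotient reduces to comparing a step with its
    half. *)
Definition halfpow (p : nat) : R := 2^-1 ^+ p.

Lemma halfpow_gt0 p : 0 < halfpow p.
Proof. by rewrite exprn_gt0// invr_gt0. Qed.

Lemma cvg_halfpow : halfpow p @[p --> \oo] --> 0.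
Proof. by apply: cvg_expr; rewrite ger0_norm// invf_lt1// ltr1n. Qed.

Definition expdq (p : nat) (a : R) : R := (1 - expR (- (halfpow p * a))) / halfpow p.

Lemma expdq_ge0 p a : 0 <= a -> 0 <= expdq p a.
Proof.
move=> a0; have e0 := halfpow_gt0 p.
rewrite divr_ge0 ?(ltW e0)// subr_ge0 -expR0 ler_expR oppr_le0.
by rewrite mulr_ge0// ltW.
Qed.

Lemma expdq_le p a : 0 <= a -> expdq p a <= a.
Proof.
move=> a0; have e0 := halfpow_gt0 p.
rewrite ler_pdivrMr// mulrC lerBlDr -lerBlDl.
exact: expR_ge1Dx.
Qed.

Lemma expdq_ge p a : 0 <= a -> a / (1 + halfpow p * a) <= expdq p a.
Proof.
move=> a0; have e0 := halfpow_gt0 p.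
have ea0 : 0 <= halfpow p * a by rewrite mulr_ge0// ltW.
have d0 : 0 < 1 + halfpow p * a by rewrite ltr_wpDr.
rewrite ler_pdivlMr// lerBrDr -lerBrDl expRN.
rewrite (_ : 1 - _ = (1 + halfpow p * a)^-1); last first.
  by field; rewrite gt_eqF.
by rewrite lef_pV2 ?posrE ?expR_gt0// expR_ge1Dx.
Qed.

(** With [y] the exponential for the smaller step, [1 - y^2 = (1 - y)(1 + y)] is at most
    [2 (1 - y)]. *)
Lemma expdq_nd a : 0 <= a -> {homo expdq ^~ a : m n / (m <= n)%N >-> m <= n}.
Proof.
move=> a0; apply: (nondecreasing_seqP (expdq ^~ a)).1 => p.
have e0 := halfpow_gt0 p.+1.
have eE : halfpow p = halfpow p.+1 * 2 by rewrite /halfpow exprSr mulfVK.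
set y := expR (- (halfpow p.+1 * a)).
have yE : expR (- (halfpow p * a)) = y ^+ 2.
  by rewrite /y -expRM_natr eE; congr expR; ring.
rewrite /expdq yE -/y eE ler_pdivrMr; last by rewrite mulr_gt0.
rewrite [leRHS](_ : _ = (1 - y) * 2); last by field; rewrite gt_eqF.
rewrite -[leLHS](_ : (1 - y) * (1 + y) = _); last by ring.
rewrite ler_wpM2l// ?subr_ge0.
  by rewrite /y -expR0 ler_expR oppr_le0 mulr_ge0// ltW.
rewrite -[leRHS]/(1 + 1) lerD2l /y -expR0 ler_expR oppr_le0 mulr_ge0//.
exact: ltW.
Qed.

(** A squeeze between [u p / (1 + halfpow p * u p)] and [u p]. The argument varies with [p] because
    [halfder_expN] inserts the difference quotient of the exponent. *)
Lemma cvg_expdq (u : nat -> R) (a : R) : (forall p, 0 <= u p) ->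
  u p @[p --> \oo] --> a -> expdq p (u p) @[p --> \oo] --> a.
Proof.
move=> u0 ua.
apply: (@squeeze_cvgr _ _ _ _ (fun p => u p / (1 + halfpow p * u p)) u) => //.
  by apply: nearW => p; rewrite expdq_le// expdq_ge.
rewrite -[a in _ --> a]divr1 -[1 in X in _ --> X]addr0 -(mul0r a).
apply: cvgM => //; apply: cvgV; first by rewrite mul0r addr0 oner_eq0.
by apply: cvgD; [exact: cvg_cst|apply: cvgM => //; exact: cvg_halfpow].
Qed.

Lemma cvg_expdq_ereal (m : \bar R) : (0 <= m)%E ->
  ((1 - expeR (- ((halfpow p)%:E * m))) * ((halfpow p)^-1)%:E)%E @[p --> \oo] --> m.
Proof.
case: m => [a| |]// a0.
  rewrite lee_fin in a0.
  have -> : (fun p => ((1 - expeR (- ((halfpow p)%:E * a%:E))) *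
      ((halfpow p)^-1)%:E)%E) = EFin \o (fun p => expdq p a) by [].
  apply: cvg_EFin; first by near=> p.
  by apply: cvg_expdq => //; exact: cvg_cst.
(* At [m = +oo] the exponential is 0 and the quotient is exactly [2 ^ p]. *)
have -> : (fun p => ((1 - expeR (- ((halfpow p)%:E * +oo))) *
      ((halfpow p)^-1)%:E)%E) = fun p => (2 ^+ p)%:E.
  apply/funext => p; rewrite gt0_muley ?lte_fin ?halfpow_gt0//= sube0 mul1e.
  by rewrite /halfpow exprVn invrK.
apply/cvgeyPge => A; near=> p; rewrite lee_fin.
have -> : 2 ^+ p = (2 ^ p)%N%:R :> R by rewrite natrX.
apply: (@le_trans _ _ p%:R); last by rewrite ler_nat ltnW// ltn_expl.
apply: (le_trans (ltW (truncnS_gt A))); rewrite ler_nat.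
by near: p; exists (Num.truncn A).+1.
Unshelve. all: by end_near. Qed.

Lemma expdq_ereal_nd (m : \bar R) : (0 <= m)%E ->
  {homo (fun p => (1 - expeR (- ((halfpow p)%:E * m))) * ((halfpow p)^-1)%:E)%E :
    p q / (p <= q)%N >-> (p <= q)%E}.
Proof.
case: m => [a| |]// a0 p q pq; first by rewrite lee_fin expdq_nd.
rewrite !gt0_muley ?lte_fin ?halfpow_gt0//= sube0 !mul1e lee_fin.
rewrite lef_pV2 ?posrE ?halfpow_gt0// /halfpow.
by rewrite ler_wiXn2l// invf_le1// ler1n.
Qed.

(** Minus the right derivative at 0, sampled at the steps [halfpow p]; the sign suits quantities
    that decrease under the perturbation. *)
Definition halfder (u : nat -> R) (u0 u' : R) : Prop :=
  ((u0 - u p) / halfpow p) @[p --> \oo] --> u'.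

Lemma halfder_cvg u u0 u' : halfder u u0 u' -> u p @[p --> \oo] --> u0.
Proof.
move=> h; rewrite -[u0 in _ --> u0]subr0 -(mulr0 u').
have -> : u = fun p => u0 - (u0 - u p) / halfpow p * halfpow p.
  by apply/funext => p; rewrite divfK ?gt_eqF ?halfpow_gt0// subKr.
by apply: cvgB; [exact: cvg_cst|apply: cvgM => //; exact: cvg_halfpow].
Qed.

Lemma halfderM u u0 u' v v0 v' : halfder u u0 u' -> halfder v v0 v' ->
  halfder (fun p => u p * v p) (u0 * v0) (u' * v0 + u0 * v').
Proof.
move=> hu hv; rewrite /halfder.
have -> : (fun p => (u0 * v0 - u p * v p) / halfpow p) =
    fun p => (u0 - u p) / halfpow p * v0 + u p * ((v0 - v p) / halfpow p).
  by apply/funext => p; field; rewrite gt_eqF ?halfpow_gt0.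
apply: cvgD; first by apply: cvgM => //; exact: cvg_cst.
by apply: cvgM => //; exact: halfder_cvg hu.
Qed.

(** The quotient equals [expR (- u0)] times [expdq] evaluated at the difference quotient of the
    exponent, so [cvg_expdq] gives the limit. *)
Lemma halfder_expN u u0 u' : (forall p, u0 <= u p) ->
  (u p - u0) / halfpow p @[p --> \oo] --> u' ->
  halfder (fun p => expR (- u p)) (expR (- u0)) (expR (- u0) * u').
Proof.
move=> uge hu; rewrite /halfder.
have -> : (fun p => (expR (- u0) - expR (- u p)) / halfpow p) =
    fun p => expR (- u0) * expdq p ((u p - u0) / halfpow p).
  apply/funext => p; rewrite /expdq mulrA mulrBr mulr1 -expRD; congr ((_ - expR _) / _).
  by field; rewrite gt_eqF ?halfpow_gt0.
apply: cvgM; first exact: cvg_cst.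
apply: cvg_expdq => // p.
by rewrite divr_ge0 ?subr_ge0 ?uge// ltW// halfpow_gt0.
Qed.

End halving_difference_quotient.

(** * Mixed moments of a Poisson random measure *)

(** From [(1 + s) e^-s <= 1] one gets [s <= (1 + s)(1 - e^-s)]. The remaining factor
    [s^k (1 + s) e^-s] is bounded by [k! + (k+1)!], because [s^j <= j! e^s]. Integrability of
    [1 - e^-s] thus controls every moment of positive order. *)
Lemma exprn_expRN_le (R : realType) (s : R) (k : nat) : 0 <= s ->
  s ^+ k.+1 * expR (- s) <= (k`!%:R + k.+1`!%:R) * (1 - expR (- s)).
Proof.
move=> s0.
have pw j : s ^+ j <= j`!%:R * expR s.
  have f0 : 0 < j`!%:R :> R by rewrite ltr0n fact_gt0.
  rewrite mulrC -ler_pdivrMr// -lee_fin -nneseries_exp_coeff.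
  apply: le_trans (nneseries_lim_ge j.+1 _); last first.
    by move=> i _ _; rewrite lee_fin divr_ge0// exprn_ge0.
  rewrite big_nat_recr//= leeDr//.
  by apply: sume_ge0 => i _; rewrite lee_fin divr_ge0// exprn_ge0.
have e0 := expR_gt0 (- s).
have h1 : s * expR (- s) <= (1 + s) * expR (- s) * (1 - expR (- s)).
  rewrite mulrAC ler_wpM2r ?(ltW e0)// mulrBr mulr1 lerBrDr -lerBrDl.
  rewrite (_ : 1 + s - s = 1); last by ring.
  by rewrite expRN -ler_pdivlMr ?invr_gt0 ?expR_gt0// invrK mul1r expR_ge1Dx.
have h2 : (s ^+ k + s ^+ k.+1) * expR (- s) <= k`!%:R + k.+1`!%:R.
  rewrite expRN -ler_pdivlMr ?invr_gt0 ?expR_gt0// invrK mulrDl.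
  by rewrite lerD.
have e1 : 0 <= 1 - expR (- s) by rewrite subr_ge0 -expR0 ler_expR oppr_le0.
apply: le_trans (ler_wpM2r e1 h2).
rewrite exprSr -mulrA.
apply: (le_trans (ler_wpM2l (exprn_ge0 k s0) h1)).
by rewrite le_eqVlt; apply/orP; left; apply/eqP; ring.
Qed.

Section tilted_moments.
Local Open Scope ereal_scope.
Context (R : realType).
Variable nu : {measure set R -> \bar R}.
Hypothesis nu_int : \int[nu]_(s in `]0%R, +oo[) (1 - expR (- s))%:E < +oo.

(** A class of exponents containing the identity and stable under adding [e s^n]. The bound
    [s <= g s] makes the tilted moments finite, and [g 0 = 0] lets padding jumps contribute
    nothing. *)
Definition tilt (g : R -> R) : Prop :=
  [/\ measurable_fun setT g, forall s, (0 <= s -> s <= g s)%R, g 0%R = 0%R &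
      \int[nu]_(s in `]0%R, +oo[) (1 - expR (- g s))%:E < +oo].

Definition tmoment (g : R -> R) (m : nat) : \bar R :=
  \int[nu]_(s in `]0%R, +oo[) (s ^+ m * expR (- g s))%:E.

(** The Laplace exponent: minus the logarithm of the expectation of [exp (- \sum_k g (r_k))] for
    points of intensity [nu]. *)
Definition texponent (g : R -> R) : \bar R :=
  \int[nu]_(s in `]0%R, +oo[) (1 - expR (- g s))%:E.

Let D0 : set R := `]0%R, +oo[.

Let mD0 : measurable D0. Proof. exact: measurable_itv. Qed.

Let D0_gt0 (s : R) : `]0%R, +oo[%classic s -> (0 < s)%R.
Proof. by rewrite /= in_itv /= andbT. Qed.

Lemma tilt_id : tilt idfun.
Proof. by split => //; exact: measurable_id. Qed.

Lemma measurable_tmoment (g : R -> R) m : measurable_fun setT g ->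
  measurable_fun D0 (fun s : R => (s ^+ m * expR (- g s))%:E).
Proof.
move=> mg; apply/measurable_EFinP; apply: measurable_funTS.
apply: measurable_funM; first exact: measurable_funX.
by apply: measurableT_comp => //; exact: measurableT_comp.
Qed.

Lemma measurable_texponent (g : R -> R) : measurable_fun setT g ->
  measurable_fun D0 (fun s : R => (1 - expR (- g s))%:E).
Proof.
move=> mg; apply/measurable_EFinP; apply: measurable_funTS.
apply: measurable_funB => //.
by apply: measurableT_comp => //; exact: measurableT_comp.
Qed.

Lemma measurable_one_sub_expRN :
  measurable_fun D0 (fun s : R => (1 - expR (- s))%:E).
Proof. by apply: (@measurable_texponent idfun); exact: measurable_id. Qed.

Lemma tmoment_ge0 g m : 0 <= tmoment g m.
Proof.
apply: integral_ge0 => s /D0_gt0 s0.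
by rewrite lee_fin mulr_ge0 ?expR_ge0// exprn_ge0// ltW.
Qed.

Lemma texponent_ge0 g : tilt g -> 0 <= texponent g.
Proof.
move=> [_ gs _ _]; apply: integral_ge0 => s /D0_gt0 s0.
rewrite lee_fin subr_ge0 -expR0 ler_expR oppr_le0 (le_trans (ltW s0))// gs//.
exact: ltW.
Qed.

(** The moment of order 0 is excluded: it is infinite when [nu] has infinitely many small jumps. *)
Lemma tmoment_lty g m : tilt g -> (0 < m)%N -> tmoment g m < +oo.
Proof.
move=> [mg gs _ _]; case: m => // m _.
pose C : R := (m`!%:R + m.+1`!%:R)%R.
apply: (@le_lt_trans _ _ (C%:E * \int[nu]_(s in D0) (1 - expR (- s))%:E)).
  rewrite -ge0_integralZl_EFin//; last 3 first.
  - move=> s /D0_gt0 s0; rewrite lee_fin subr_ge0 -expR0 ler_expR oppr_le0.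
    exact: ltW.
  - exact: measurable_one_sub_expRN.
  - by rewrite addr_ge0.
  apply: ge0_le_integral => //.
  - move=> s /D0_gt0 s0; rewrite lee_fin mulr_ge0 ?expR_ge0// exprn_ge0//.
    exact: ltW.
  - exact: measurable_tmoment.
  - by apply: measurable_funeM; exact: measurable_one_sub_expRN.
  - move=> s /D0_gt0 s0; rewrite -EFinM lee_fin.
    apply: le_trans (exprn_expRN_le m (ltW s0)).
    by rewrite ler_wpM2l ?exprn_ge0 ?(ltW s0)// ler_expR lerN2 gs// ltW.
apply: lte_mul_pinfty; rewrite ?lee_fin ?addr_ge0//.
Qed.

Lemma tmoment_fin g m : tilt g -> (0 < m)%N -> tmoment g m \is a fin_num.
Proof. by move=> tg m0; rewrite ge0_fin_numE; [exact: tmoment_lty|exact: tmoment_ge0]. Qed.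

Lemma texponent_fin g : tilt g -> texponent g \is a fin_num.
Proof. by move=> tg; rewrite ge0_fin_numE; [case: tg|exact: texponent_ge0]. Qed.

Section perturbation.
Variables (g : R -> R) (n : nat).
Hypotheses (tg : tilt g) (n0 : (0 < n)%N).

Let gp (p : nat) (s : R) : R := (g s + halfpow R p * s ^+ n)%R.

(** The common difference quotient, as an integral of nonnegative functions increasing in [p]: it is
    the decrease of the moment of order [m], and for [m = 0] the increase of the Laplace exponent,
    each divided by [halfpow p]. *)
Let J (p m : nat) : \bar R :=
  \int[nu]_(s in D0) (s ^+ m * expR (- g s) * expdq p (s ^+ n))%:E.

Let mg : measurable_fun setT g. Proof. by case: tg. Qed.

Let mJ p m : measurable_fun D0
  (fun s : R => (s ^+ m * expR (- g s) * expdq p (s ^+ n))%:E).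
Proof.
have := measurable_tmoment m mg; move/measurable_EFinP => mt.
apply/measurable_EFinP; apply: measurable_funM => //.
apply: measurable_funM => //; apply: measurable_funB => //.
apply: measurableT_comp => //; apply: measurableT_comp => //.
by apply: measurable_funM => //; apply: measurable_funTS.
Qed.

Let J_ge0 p m s : D0 s -> 0 <= (s ^+ m * expR (- g s) * expdq p (s ^+ n))%:E.
Proof.
move=> /D0_gt0/ltW s0; rewrite lee_fin; apply: mulr_ge0.
  by apply: mulr_ge0; [exact: exprn_ge0|exact: expR_ge0].
by apply: expdq_ge0; exact: exprn_ge0.
Qed.

Let cvg_J m : J p m @[p --> \oo] --> tmoment g (m + n).
Proof.
rewrite /tmoment -/D0.
rewrite (_ : \int[nu]_(s in D0) _ = \int[nu]_(s in D0)
    limn (fun p => (s ^+ m * expR (- g s) * expdq p (s ^+ n))%:E)).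
  apply: cvg_monotone_convergence => //.
    by move=> p s; exact: J_ge0.
  move=> s /D0_gt0 s0 p q pq; rewrite lee_fin ler_wpM2l//.
    by rewrite mulr_ge0 ?expR_ge0// exprn_ge0// ltW.
  by apply: expdq_nd => //; rewrite exprn_ge0// ltW.
apply: eq_integral => s /set_mem/D0_gt0 s0; apply/esym/cvg_lim => //.
apply: cvg_EFin; first by near=> p.
rewrite exprD mulrAC; apply: cvgM; first exact: cvg_cst.
by apply: cvg_expdq => [p|]; [rewrite exprn_ge0// ltW|exact: cvg_cst].
Unshelve. all: by end_near. Qed.

Let expRgp p s : (halfpow R p * expdq p (s ^+ n) = 1 - expR (- (halfpow R p * s ^+ n)))%R.
Proof. by rewrite /expdq mulrC divfK// gt_eqF ?halfpow_gt0. Qed.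

Let tmoment_gp p m : tmoment g m = tmoment (gp p) m + (halfpow R p)%:E * J p m.
Proof.
have e0 := halfpow_gt0 R p.
have mgp : measurable_fun setT (gp p).
  by apply: measurable_funD => //; apply: measurable_funM.
rewrite /J -ge0_integralZl_EFin//; last 2 first.
- by move=> s; exact: J_ge0.
- exact: ltW.
rewrite /tmoment -ge0_integralD//; last 4 first.
- move=> s /D0_gt0 s0; rewrite lee_fin mulr_ge0 ?expR_ge0// exprn_ge0//.
  exact: ltW.
- exact: measurable_tmoment.
- by move=> s sD; rewrite mule_ge0 ?J_ge0// lee_fin ltW.
- exact: measurable_funeM.
apply: eq_integral => s _; rewrite -EFinM -EFinD; congr EFin.
rewrite mulrCA expRgp /gp opprD expRD; ring.
Qed.

Let texponent_gp p : texponent (gp p) = texponent g + (halfpow R p)%:E * J p 0.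
Proof.
have e0 := halfpow_gt0 R p.
have gs := let: And4 _ gs _ _ := tg in gs.
rewrite /J -ge0_integralZl_EFin//; last 2 first.
- by move=> s; exact: J_ge0.
- exact: ltW.
rewrite /texponent -ge0_integralD//; last 4 first.
- move=> s /D0_gt0 s0; rewrite lee_fin subr_ge0 -expR0 ler_expR oppr_le0.
  by rewrite (le_trans (ltW s0))// gs// ltW.
- exact: measurable_texponent.
- by move=> s sD; rewrite mule_ge0 ?J_ge0// lee_fin ltW.
- exact: measurable_funeM.
apply: eq_integral => s _; rewrite -EFinM -EFinD; congr EFin.
by rewrite expr0 mul1r mulrCA expRgp /gp opprD expRD; ring.
Qed.

Let J_lty p m : (0 < m + n)%N -> J p m < +oo.
Proof.
move=> mn; apply: le_lt_trans (tmoment_lty tg mn).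
apply: ge0_le_integral => //.
- by move=> s; exact: J_ge0.
- exact: measurable_tmoment.
- move=> s /D0_gt0 s0; rewrite lee_fin exprD [leRHS]mulrAC ler_wpM2l//.
    by rewrite mulr_ge0 ?expR_ge0// exprn_ge0// ltW.
  by rewrite expdq_le// exprn_ge0// ltW.
Qed.

Let J_fin p m : J p m \is a fin_num.
Proof.
rewrite ge0_fin_numE; first by rewrite J_lty// addn_gt0 n0 orbT.
by apply: integral_ge0 => s; exact: J_ge0.
Qed.

Lemma tilt_perturb p : tilt (gp p).
Proof.
have e0 := halfpow_gt0 R p.
case: (tg) => [_ gs g0 gint]; split.
- by apply: measurable_funD => //; apply: measurable_funM.
- move=> s s0; rewrite (le_trans (gs _ s0))// lerDl mulr_ge0 ?(ltW e0)//.
  by rewrite exprn_ge0.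
- by rewrite /gp g0 expr0n gtn_eqF// mulr0 addr0.
- rewrite [ltLHS]texponent_gp lte_add_pinfty//.
  by apply: lte_mul_pinfty; rewrite ?lee_fin ?(ltW e0)// J_lty.
Qed.

Lemma halfder_tmoment m : (0 < m)%N -> halfder (fun p => fine (tmoment (gp p) m))
  (fine (tmoment g m)) (fine (tmoment g (m + n))).
Proof.
move=> m0; rewrite /halfder.
have -> : (fun p => (fine (tmoment g m) - fine (tmoment (gp p) m)) / halfpow R p)%R =
    fun p => fine (J p m).
  apply/funext => p; rewrite (tmoment_gp p) fineD ?fin_numM//; last first.
    exact: tmoment_fin (tilt_perturb p) m0.
  by rewrite fineM//= addrAC subrr add0r mulrAC divff ?mul1r// gt_eqF ?halfpow_gt0.
apply: fine_cvg; rewrite fineK; first exact: cvg_J.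
by rewrite tmoment_fin// addn_gt0 m0.
Qed.

Lemma halfder_texponent :
  halfder (fun p => expR (- fine (texponent (gp p)))) (expR (- fine (texponent g)))
    (expR (- fine (texponent g)) * fine (tmoment g n)).
Proof.
have gE p : (fine (texponent (gp p)) =
    fine (texponent g) + halfpow R p * fine (J p 0))%R.
  by rewrite texponent_gp fineD ?fin_numM ?texponent_fin// fineM.
apply: halfder_expN.
  move=> p; rewrite gE lerDl mulr_ge0 ?(ltW (halfpow_gt0 _ _))// fine_ge0//.
  by apply: integral_ge0 => s; exact: J_ge0.
have -> : (fun p => (fine (texponent (gp p)) - fine (texponent g)) / halfpow R p)%R =
    fun p => fine (J p 0).
  apply/funext => p; rewrite gE addrAC subrr add0r mulrAC divff ?mul1r//.
  by rewrite gt_eqF ?halfpow_gt0.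
by apply: fine_cvg; rewrite fineK ?tmoment_fin//; exact: (cvg_J 0).
Qed.

(** Differentiating one factor multiplies its integrand by [s^n], so the Leibniz rule runs over
    [bumps], exactly the collision terms of [dsumM]. *)
Lemma halfder_prod_tmoment ns : all (fun m => 0 < m)%N ns ->
  halfder (fun p => \prod_(m <- ns) fine (tmoment (gp p) m))%R
    (\prod_(m <- ns) fine (tmoment g m))%R
    (\sum_(l <- bumps n ns) \prod_(m <- l) fine (tmoment g m))%R.
Proof.
elim: ns => [_|m ns ih /= /andP[m0 /ih h]].
  rewrite [X in halfder _ _ X]big_nil.
  have -> : (fun p => \prod_(m <- [::]) fine (tmoment (gp p) m))%R = cst 1%R.
    by apply/funext => p; rewrite big_nil.
  rewrite big_nil /halfder (_ : (fun p => _) = cst 0%R); first exact: cvg_cst.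
  by apply/funext => p; rewrite subrr mul0r.
have := halfderM (halfder_tmoment m0) h.
set u := (fun p => _ * _)%R; set u0 := (_ * _)%R; set u' := (_ + _)%R => hu.
have -> : (fun p => \prod_(j <- m :: ns) fine (tmoment (gp p) j))%R = u.
  by apply/funext => p; rewrite big_cons.
rewrite big_cons -/u0 (_ : (\sum_(l <- _) _)%R = u')//.
rewrite /u' /= big_cons big_map big_cons mulr_sumr; congr (_ + _)%R.
by apply: eq_bigr => l _; rewrite big_cons.
Qed.

End perturbation.
End tilted_moments.

Section poisson_moments.
Local Open Scope ereal_scope.
Context d (T : measurableType d) (R : realType).
Variables (P : probability T R) (x : nat -> T -> R).
Variable nu : {measure set R -> \bar R}.
Hypothesis mx : forall k, measurable_fun setT (x k).
Hypothesis x0 : forall k t, (0 <= x k t)%R.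
Hypothesis laplace : forall h : R -> R, measurable_fun setT h ->
  (forall s, 0 <= s -> 0 <= h s)%R -> h 0%R = 0%R ->
  \int[P]_t expeR (- \sum_(k <oo) (h (x k t))%:E) =
  expeR (- \int[nu]_(s in `]0%R, +oo[) (1 - expR (- h s))%:E).
Hypothesis nu_int : \int[nu]_(s in `]0%R, +oo[) (1 - expR (- s))%:E < +oo.

Let psum (h : R -> R) (t : T) : \bar R := \sum_(k <oo) (h (x k t))%:E.

Let mgf (ns : seq nat) (g : R -> R) : \bar R :=
  \int[P]_t (dsum (x ^~ t) ns [::] * expeR (- psum g t)).

Let moment (ns : seq nat) (g : R -> R) : R :=
  (\prod_(m <- ns) fine (tmoment nu g m) * expR (- fine (texponent nu g)))%R.

Let mintegrand ns g : tilt nu g ->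
  measurable_fun setT (fun t => dsum (x ^~ t) ns [::] * expeR (- psum g t)).
Proof.
move=> [mg gs _ _]; apply: emeasurable_funM; first exact: measurable_dsum.
apply: measurable_expeRN; apply: measurable_psum => // s s0.
by rewrite (le_trans s0)// gs.
Qed.

Let integrand_ge0 ns g t : 0 <= dsum (x ^~ t) ns [::] * expeR (- psum g t).
Proof. by rewrite mule_ge0 ?expeR_ge0// dsum_ge0. Qed.

(* One more index is brought in by differentiating at [e = 0] the formula for
   [g + e s^n]: the derivative contributes the factor [\sum_k x_k^n] to the
   left-hand side, and [dsumM] isolates the terms with a new index. *)
Lemma expectation_dsum_expeRN ns g : all (leq 1) ns -> tilt nu g ->
  \int[P]_t (dsum (x ^~ t) ns [::] * expeR (- \sum_(k <oo) (g (x k t))%:E)) =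
  (\prod_(m <- ns) fine (tmoment nu g m) * expR (- fine (texponent nu g)))%:E.
Proof.
rewrite -/(mgf ns g) -/(moment ns g).
(* Induction on the length: the lists in [bumps n ns] are as long as [ns] but are not sublists of
   it. *)
move: {2}(size ns) (erefl (size ns)) => N.
elim: N ns g => [|N ih] ns g.
  case: ns => // _ _ tg; rewrite /mgf /moment big_nil mul1r /=.
  under eq_integral do rewrite mul1e.
  case: (tg) => [mg gs g0 _]; rewrite laplace// => [|s s0]; last first.
    by rewrite (le_trans s0)// gs.
  by rewrite -/(texponent nu g) -[X in expeR (- X)]fineK// texponent_fin.
case/lastP: ns => // ns n; rewrite size_rcons => -[sN]; rewrite all_rcons => /andP[n0 ns0] tg.
have [mg gs g0 _] := tg.
pose gp p (s : R) := (g s + halfpow R p * s ^+ n)%R.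
have tgp p : tilt nu (gp p) by exact: tilt_perturb.
pose M t := \sum_(k <oo) (x k t ^+ n)%:E.
have M0 t : 0 <= M t by apply: nneseries_ge0 => k _ _; rewrite lee_fin exprn_ge0.
have mM : measurable_fun setT M.
  by apply: (@measurable_psum _ _ _ x mx x0 (fun s => s ^+ n)%R) => // s; exact: exprn_ge0.
pose c t := dsum (x ^~ t) ns [::] * expeR (- psum g t).
have c0 t : 0 <= c t by exact: integrand_ge0.
have mc : measurable_fun setT c by exact: mintegrand.
pose y p t := expeR (- ((halfpow R p)%:E * M t)).
have my p : measurable_fun setT (y p).
  by apply: measurable_expeRN; exact: measurable_funeM.
have eM0 p t : 0 <= (halfpow R p)%:E * M t.
  by rewrite mule_ge0// lee_fin ltW// halfpow_gt0.
have y0 p t : 0 <= 1 - y p t.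
  by rewrite sube_ge0 ?expeRN_fin_num// expeRN_le1.
pose v p t := (1 - y p t) * ((halfpow R p)^-1)%:E.
have v0 p t : 0 <= v p t.
  by rewrite mule_ge0// lee_fin invr_ge0 ltW// halfpow_gt0.
have mv p : measurable_fun setT (v p).
  apply: emeasurable_funM => //; exact: emeasurable_funB.
have psum_gp p t : psum (gp p) t = psum g t + (halfpow R p)%:E * M t.
  rewrite /M -nneseriesZl; last by move=> k _; rewrite lee_fin exprn_ge0.
  have h0 := ltW (halfpow_gt0 R p).
  rewrite -nneseriesD// => k _ _.
    by rewrite lee_fin (le_trans (x0 k t))// gs.
  by rewrite -EFinM lee_fin; apply: mulr_ge0 => //; exact: exprn_ge0.
have psum0 t : 0 <= psum g t.
  by apply: nneseries_ge0 => k _ _; rewrite lee_fin (le_trans (x0 k t))// gs.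
have gpE p t : dsum (x ^~ t) ns [::] * expeR (- psum (gp p) t) = c t * y p t.
  by rewrite psum_gp oppeD ?ge0_adde_def ?inE// expeRD muleA.
(* The induction hypothesis at both [g] and [gp p] turns this integral into a difference quotient of
   the closed formula. *)
have cv p : \int[P]_t (c t * v p t) =
    ((moment ns g - moment ns (gp p)) / halfpow R p)%:E.
  have -> : \int[P]_t (c t * v p t) =
      ((halfpow R p)^-1)%:E * \int[P]_t (c t * (1 - y p t)).
    rewrite -ge0_integralZl_EFin//.
    - by apply: eq_integral => t _; rewrite /v muleA muleC.
    - by move=> t _; rewrite mule_ge0.
    - by apply: emeasurable_funM => //; exact: emeasurable_funB.
    - by rewrite invr_ge0 ltW// halfpow_gt0.
  have S : mgf ns g = \int[P]_t (c t * (1 - y p t)) + mgf ns (gp p).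
    rewrite /mgf -ge0_integralD//.
    - apply: eq_integral => t _; rewrite gpE -ge0_muleDr//; last exact: expeR_ge0.
      by rewrite subeK ?mule1// expeRN_fin_num.
    - by move=> t _; rewrite mule_ge0.
    - by apply: emeasurable_funM => //; exact: emeasurable_funB.
    - exact: mintegrand.
  rewrite (ih ns g sN ns0 tg) (ih ns (gp p) sN ns0 (tgp p)) in S.
  move: S; move: (moment ns g) (moment ns (gp p)) => a b S.
  by rewrite EFinM EFinB S addeK// muleC.
(* The left-hand derivative, valid even where [M t] is infinite. *)
have lim1 : \int[P]_t (c t * v p t) @[p --> \oo] --> \int[P]_t (c t * M t).
  rewrite (_ : \int[P]_t (c t * M t) =
      \int[P]_t limn (fun p => c t * v p t)).
    apply: cvg_monotone_convergence => //.
    - by move=> p; exact: emeasurable_funM.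
    - by move=> p t _; exact: mule_ge0.
    - by move=> t _ p q pq; rewrite lee_wpmul2l// expdq_ereal_nd.
  apply: eq_integral => t _; apply/esym/cvg_lim => //.
  apply: ge0_nd_cvgeMl => //; first exact: expdq_ereal_nd.
  exact: cvg_expdq_ereal.
pose pr l := (\prod_(m <- l) fine (tmoment nu g m))%R.
have lim2 : \int[P]_t (c t * v p t) @[p --> \oo] -->
    ((\sum_(l <- bumps n ns) moment l g) + moment (rcons ns n) g)%:E.
  under eq_fun do rewrite cv.
  apply: cvg_EFin; first by near=> p.
  have H := halfderM (halfder_prod_tmoment nu_int tg n0 ns0)
    (halfder_texponent nu_int tg n0).
  rewrite (_ : (_ + _)%R = (\sum_(l <- bumps n ns) pr l *
      expR (- fine (texponent nu g)) + pr ns *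
      (expR (- fine (texponent nu g)) * fine (tmoment nu g n)))%R).
    by rewrite -mulr_suml; exact: H.
  congr (_ + _)%R; rewrite /moment -cats1 big_cat big_seq1 -mulrA.
  by congr (_ * _)%R; rewrite mulrC.
have bumps_size l : l \in bumps n ns -> size l = N /\ all (leq 1) l.
  rewrite -sN; elim: ns {sN c c0 mc gpE cv lim1 lim2} ns0 l => //= m ms ihm /andP[m0 ms0] l.
  rewrite inE => /orP[/eqP ->|/mapP[l' /ihm[//|<- l'0] ->]] /=.
    by rewrite addn_gt0 m0 ms0.
  by rewrite m0 l'0.
have E : \int[P]_t (c t * M t) =
    mgf (rcons ns n) g + (\sum_(l <- bumps n ns) moment l g)%:E.
  have -> : (\sum_(l <- bumps n ns) moment l g)%:E =
      \sum_(l <- bumps n ns) mgf l g.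
    rewrite -sumEFin; apply: eq_big_seq => l lb.
    have [sl l0] := bumps_size l lb.
    by rewrite (ih l g sl l0 tg).
  rewrite -ge0_integral_sum//; last first.
  - by move=> l; exact: mintegrand.
  rewrite -ge0_integralD//.
  - apply: eq_integral => t _; rewrite /c muleAC dsumM// big_nil adde0.
    rewrite ge0_muleDl ?dsum_ge0 ?sume_ge0//; last by move=> l _; exact: dsum_ge0.
    by rewrite ge0_sume_distrl// => l _; exact: dsum_ge0.
  - exact: mintegrand.
  - by move=> t _; exact: sume_ge0.
  - by apply: emeasurable_sum => l; exact: mintegrand.
have := cvg_lim (@ereal_hausdorff R) lim1.
rewrite (cvg_lim (@ereal_hausdorff R) lim2) E EFinD addeC.
(* The collision terms form a real number and can be subtracted, leaving the integral for
   [rcons ns n]. *)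
move: (\sum_(l <- _) _)%R (moment (rcons ns n) g) => a b.
by move=> /(_ _) /(congr1 (fun z => z - a%:E)); rewrite !addeK// => ->.
Unshelve. all: by end_near. Qed.

End poisson_moments.

(** * The mixed Poisson model *)

Section model_consequences.
Context d (T : measurableType d) (R : realType).
Variables (P : probability T R) (Om : completeMetricType R).
Variables (r : nat -> {RV P >-> R}) (w : nat -> {RV P >-> borelType Om}).
Variables (size : {RV P >-> nat}) (c : nat -> {RV P >-> nat}).
Variables (rho : {measure set R -> \bar R}).
Variable G0 : {finite_measure set (borelType Om) -> \bar R}.
Hypothesis model : crm_mixed_poisson r w size c rho G0.

Let S (t : T) : \bar R := (\sum_(k <oo) (r k t)%:E)%E.

Let crmT t : crm r w t setT = S t.
Proof. by apply: eq_eseriesr => k _; rewrite diracE in_setT mule1. Qed.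

Let point_measureX t (B : set R) :
  point_measure r w t (B `*` setT) = (\sum_(k <oo) (\1_B (r k t))%:E)%E.
Proof.
apply: eq_eseriesr => k _; rewrite diracE indicE /crm_point.
by rewrite in_setX/= in_setT andbT.
Qed.

Lemma jumps_poisson (B : set R) : measurable B -> B `<=` `]0, +oo[ ->
  has_poisson_law P (fun t => \sum_(k <oo) (\1_B (r k t))%:E)%E
    (rho B * G0 setT)%E.
Proof.
move=> mB B0; have [H _] := points_poisson model.
have := H (B `*` setT); rewrite product_measure1E//.
rewrite (_ : (fun t => point_measure r w t _) =
  fun t => (\sum_(k <oo) (\1_B (r k t))%:E)%E); last first.
  by apply/funext => t; exact: point_measureX.
apply; first exact: measurableX.
by move=> [s o] [/B0]; rewrite /= in_itv/= andbT.
Qed.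

Lemma jumps_independent (m : nat) (A : 'I_m -> set R) :
  (forall j, measurable (A j) /\ A j `<=` `]0, +oo[) -> trivIset setT A ->
  mutually_independent P (fun j t => \sum_(k <oo) (\1_(A j) (r k t))%:E)%E.
Proof.
move=> hA tA; have [_ H] := points_poisson model.
rewrite (_ : (fun j t => _) =
    fun j t => point_measure r w t (A j `*` setT)); last first.
  by apply/funext => j; apply/funext => t; rewrite point_measureX.
apply: H => [j|].
  have [mA A0] := hA j; split; first exact: measurableX.
  by move=> [s o] [/A0]; rewrite /= in_itv/= andbT.
apply/trivIsetP => i j _ _ ij; rewrite -setXI.
by move/trivIsetP : tA => -> //; rewrite set0X.
Qed.

Let gens_measurable : <<s gens_G r w >> `<=` measurable.
Proof.
apply: smallest_sub; first exact: sigma_algebra_measurable.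
move=> _ [k _] [B mB <-]; rewrite setTI /crm_point.
have m := measurable_fun_pair (measurable_funPT (r k)) (measurable_funPT (w k)).
by have := m measurableT B mB; rewrite setTI.
Qed.

(** [T] with the sigma-algebra of the random measure. The identity from [T] to [GT] plays the
    conditioning variable in [eq_ge0_integral_mul_comp]. *)
Let GT := g_sigma_algebraType (gens_G r w).

Let measurable_id_gens : measurable_fun setT (idfun : T -> GT).
Proof. by move=> _ B mB; rewrite setTI; exact: gens_measurable. Qed.

Let measurable_jump_gens k : measurable_fun setT (r k : GT -> R).
Proof.
move=> _ B mB; rewrite setTI; apply: sub_sigma_algebra; exists k => //.
exists (B `*` setT); first exact: measurableX.
by rewrite setTI; apply/seteqP; split => [t []|t].
Qed.

Let measurable_total_mass_gens : measurable_fun setT (total_mass r w : GT -> R).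
Proof.
apply: (measurableT_comp (fine_measurable measurableT)).
rewrite (_ : (fun t : GT => crm r w t setT) = S); last exact/funext/crmT.
apply: (@ge0_emeasurable_sum _ _ _ _ _ xpredT).
  by move=> k t _ _; rewrite lee_fin (jump_ge0 model).
by move=> k _; apply/measurable_EFinP; exact: measurable_jump_gens.
Qed.

Let total_mass_ge0 t : 0 <= total_mass r w t.
Proof.
rewrite fine_ge0// crmT; apply: nneseries_ge0 => k _ _.
by rewrite lee_fin (jump_ge0 model).
Qed.

(** Conditioning on the random measure replaces the indicator of [size = n] by the Poisson weight,
    whose n-th power of the total mass cancels the denominators. *)
Lemma assignment_prob (n : nat) (a : 'I_n -> nat) : (0 < n)%N ->
  (P [set t | size t = n /\ forall j : 'I_n, c j t = a j] =
   (n`!%:R^-1)%:E * \int[P]_t ((\prod_(j < n) r (a j) t)%:E *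
     expeR (- \sum_(k <oo) (r k t)%:E)))%E.
Proof.
move=> n0; have [_ H] := assignment model a.
have {H} := H setT (@measurableT _ (g_sigma_algebraType (gens_Gn r w size))).
rewrite setIT => ->.
pose phi (t : GT) : \bar R := (\prod_(j < n) (r (a j) t / total_mass r w t))%:E.
pose u (t : T) : \bar R := (\1_[set u | size u = n] t)%:E.
pose v (t : T) : \bar R := (poisson_weight (total_mass r w t) n)%:E.
have msize : measurable [set t | size t = n].
  by apply: (@measurable_funPTI _ _ _ _ size [set n]).
have mr : measurable_fun setT (fun t : T => total_mass r w t).
  exact: (measurableT_comp measurable_total_mass_gens measurable_id_gens).
have mu_ : measurable_fun setT u by apply/measurable_EFinP; exact: measurable_indic.
transitivity (\int[P]_t (u t * phi (idfun t)))%E.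
  by apply: eq_integral => t _; rewrite -EFinM.
have -> : (\int[P]_t (u t * phi (idfun t)) = \int[P]_t (v t * phi (idfun t)))%E.
  apply: (@eq_ge0_integral_mul_comp _ _ _ _ _ _ (idfun : T -> GT) u v phi) => //.
  - by move=> t; rewrite lee_fin.
  - apply/measurable_EFinP; rewrite /poisson_weight.
    apply: measurable_funM.
      by apply: measurable_funM => //; exact: measurable_funX.
    by apply: measurableT_comp => //; exact: measurableT_comp.
  - move=> t; rewrite lee_fin /poisson_weight mulr_ge0 ?expR_ge0//.
    by rewrite divr_ge0// exprn_ge0.
  - apply/measurable_EFinP; apply: measurable_prod => j _.
    apply: measurable_funM; first exact: measurable_jump_gens.
    rewrite (_ : (fun t => _) = fun t : GT => (total_mass r w t) `^ (-1)).
      exact: (measurableT_comp (measurable_powR (-1)) measurable_total_mass_gens).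
    by apply/funext => t; rewrite powR_inv1.
  - move=> t; rewrite lee_fin prodr_ge0// => j _.
    by rewrite divr_ge0// (jump_ge0 model).
  - move=> B mB; have [_ H] := size_poisson model n.
    apply: etrans (H B mB).
    by rewrite /u integral_indic//; exact: gens_measurable.
have r0 k t : 0 <= r k t := jump_ge0 model k t.
have S0 t : (0 <= S t)%E by apply: nneseries_ge0 => k _ _; rewrite lee_fin.
have mS : measurable_fun setT S.
  apply: (@ge0_emeasurable_sum _ _ _ _ _ xpredT) => k.
    by move=> t _ _; rewrite lee_fin.
  by move=> _; apply/measurable_EFinP.
rewrite -ge0_integralZl_EFin//; last 2 first.
- by move=> t _; rewrite mule_ge0 ?expeR_ge0// lee_fin prodr_ge0.
- apply: emeasurable_funM; last exact: measurable_expeRN.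
  by apply/measurable_EFinP; exact: measurable_prod.
apply: eq_integral => t _; rewrite /v /phi /= -/(S t).
have tE : total_mass r w t = fine (S t) by rewrite /total_mass crmT.
(* If the sum is infinite, [fine] makes the total mass 0, so the Poisson weight is [0^n = 0] as [n]
   is positive; on the right the exponential is 0. *)
rewrite tE; have [Soo|Soo] := eqVneq (S t) +oo%E.
  by rewrite Soo /= /poisson_weight expr0n gtn_eqF// !mul0r mul0e mule0 mule0.
have Sfin : S t \is a fin_num by rewrite ge0_fin_numE// lt_neqAle Soo leey.
have rS k : r k t <= fine (S t).
  rewrite -lee_fin fineK// /S (@nneseriesD1 _ _ k)//; last by move=> ? _; rewrite lee_fin.
  by rewrite leeDl// nneseries_ge0// => ? _ _; rewrite lee_fin.
rewrite -[in RHS](fineK Sfin) /= -!EFinM; congr EFin.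
rewrite big_split/= prodr_const card_ord /poisson_weight.
(* If the total mass is 0, then so are all jumps, and the products on both sides vanish. *)
have [s0|s0] := eqVneq (fine (S t)) 0.
  have -> : \prod_(j < n) r (a j) t = 0.
    rewrite (bigD1 (Ordinal n0))//= (_ : r _ t = 0) ?mul0r//.
    by apply/eqP; rewrite eq_le r0 andbT -s0 rS.
  by rewrite !(mul0r, mulr0).
rewrite exprVn; field; rewrite expf_neq0//=.
by rewrite pnatr_eq0 -lt0n fact_gt0.
Qed.

End model_consequences.

(** * Probability that the sample induces a given partition *)

Section partition_probability.
Context d (T : measurableType d) (R : realType).
Variables (P : probability T R) (Om : completeMetricType R).
Variables (r : nat -> {RV P >-> R}) (w : nat -> {RV P >-> borelType Om}).
Variables (N : {RV P >-> nat}) (c : nat -> {RV P >-> nat}).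
Variables (rho : {measure set R -> \bar R}).
Variable G0 : {finite_measure set (borelType Om) -> \bar R}.
Hypothesis model : crm_mixed_poisson r w N c rho G0.
Hypothesis rho_int : (\int[rho]_(s in `]0%R, +oo[) (1 - expR (- s))%:E < +oo)%E.

Let gamma0 : R := fine (G0 setT).

Let gamma0_ge0 : 0 <= gamma0. Proof. exact: fine_ge0. Qed.

Definition crm_intensity : {measure set R -> \bar R} :=
  mscale (NngNum gamma0_ge0) rho.

Let nu := crm_intensity.

Let nuE B : nu B = (rho B * G0 setT)%E.
Proof.
rewrite (_ : nu B = gamma0%:E * rho B)%E// /gamma0 fineK ?fin_num_measure//.
exact: muleC.
Qed.

Let nu_int : (\int[nu]_(s in `]0%R, +oo[) (1 - expR (- s))%:E < +oo)%E.
Proof.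
rewrite ge0_integral_mscale//.
- by apply: lte_mul_pinfty => //; rewrite lee_fin.
- exact: measurable_one_sub_expRN.
- move=> s /=; rewrite in_itv/= andbT => s0.
  by rewrite lee_fin subr_ge0 -expR0 ler_expR oppr_le0 ltW.
Qed.

Lemma tmoment_crm_intensity m : (0 < m)%N ->
  fine (tmoment nu idfun m) = gamma0 * tilted_moment rho m.
Proof.
move=> m0; rewrite /tmoment ge0_integral_mscale//.
- by rewrite fineM//; exact: (tmoment_fin rho_int (tilt_id rho_int) m0).
- by apply: (@measurable_tmoment _ idfun); exact: measurable_id.
- move=> s /=; rewrite in_itv/= andbT => s0.
  by rewrite lee_fin mulr_ge0 ?expR_ge0// exprn_ge0// ltW.
Qed.

Let r0 k t : 0 <= r k t := jump_ge0 model k t.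

Let laplace (h : R -> R) : measurable_fun setT h ->
  (forall s, 0 <= s -> 0 <= h s) -> h 0 = 0 ->
  (\int[P]_t expeR (- \sum_(k <oo) (h (r k t))%:E) =
  expeR (- \int[nu]_(s in `]0%R, +oo[) (1 - expR (- h s))%:E))%E.
Proof.
move=> mh h0 h00; apply: (laplace_functional (x := fun k t => r k t)) => //.
- by move=> B mB B0; rewrite nuE; exact: (jumps_poisson model).
- by move=> m A hA tA; exact: (jumps_independent model).
Qed.

(** Finitely many integer labels take countably many joint values, so every property of them is an
    event. *)
Lemma measurable_labels (n : nat) (Q : ('I_n -> nat) -> Prop) :
  measurable [set t | Q (fun j : 'I_n => c j t)].
Proof.
have -> : [set t | Q (fun j : 'I_n => c j t)] =
    \bigcup_(a in [set: {ffun 'I_n -> nat}])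
      [set t | Q a /\ forall j : 'I_n, c j t = a j].
  apply/seteqP; split => [t /= Qt|t [a _ [Qa /= ca]]].
    exists [ffun j : 'I_n => c j t] => //=; split; last by move=> j; rewrite ffunE.
    by rewrite (_ : fun_of_fin _ = fun j : 'I_n => c j t)//; apply/funext => j; rewrite ffunE.
  by rewrite /= (_ : (fun j : 'I_n => _) = a)//; apply/funext => j.
apply: countable_bigcupT_measurable => // a.
have [Qa|nQa] := pselect (Q a); last first.
  by rewrite (_ : [set t | _] = set0)//; apply/seteqP; split => // t [].
have -> : [set t | Q a /\ forall j : 'I_n, c j t = a j] =
    \bigcap_(j in [set: 'I_n]) (c j @^-1` [set a j]).
  by apply/seteqP; split => [t [_ h] j _|t h]; [exact: h|split => // j; exact: h].
apply: fin_bigcap_measurable => [|j _]; first exact: finite_finset.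
exact: measurable_funPTI.
Qed.

Variables (n l : nat) (b : 'I_n -> nat).
Hypotheses (n0 : (0 < n)%N) (bl : forall j, (b j < l)%N).
Hypothesis bsurj : forall m, (m < l)%N -> exists j, b j = m.

Let nb (m : nat) : nat := #|[pred j | b j == m]|.

(** The partition into the level sets of [b], with the atoms of its first [size ks] blocks revealed.
    [Ev [::]] is the partition event; with all [l] atoms revealed it is a single assignment. *)
Let Ev (ks : seq nat) : set T := [set t | [/\ N t = n,
  forall j, (b j < size ks)%N -> c j t = nth 0%N ks (b j) &
  forall j j' : 'I_n, (c j t == c j' t) = (b j == b j')]].

Let mEv ks : measurable (Ev ks).
Proof.
pose Q (a : 'I_n -> nat) := (forall j, (b j < size ks)%N -> a j = nth 0%N ks (b j)) /\
  (forall j j' : 'I_n, (a j == a j') = (b j == b j')).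
have -> : Ev ks = (N @^-1` [set n]) `&` [set t | Q (fun j : 'I_n => c j t)].
  by apply/seteqP; split => t [] //= ? [].
by apply: measurableI; [exact: measurable_funPTI|exact: (@measurable_labels n Q)].
Qed.

Let A (ks : seq nat) (t : T) : \bar R :=
  (\prod_(j < n | (b j < size ks)%N) r (nth 0%N ks (b j)) t)%:E.

Let E (t : T) : \bar R := expeR (- \sum_(k <oo) (r k t)%:E)%E.

Let mE : measurable_fun setT E.
Proof.
apply: measurable_expeRN.
apply: (@ge0_emeasurable_sum _ _ _ _ _ xpredT) => k.
  by move=> t _ _; rewrite lee_fin.
by move=> _; apply/measurable_EFinP.
Qed.

Let mA ks : measurable_fun setT (A ks).
Proof.
apply/measurable_EFinP; under eq_fun do rewrite big_mkcond.
by apply: measurable_prod => j _; case: (_ < _)%N.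
Qed.

Let A_ge0 ks t : (0 <= A ks t)%E.
Proof. by rewrite lee_fin prodr_ge0. Qed.

Let E_ge0 t : (0 <= E t)%E. Proof. exact: expeR_ge0. Qed.

(** Induction on the number of unrevealed blocks. Splitting by the atom [k] of the next block,
    necessarily outside [ks], reproduces the recursion of [dsum]. *)
Let Ev_prob q ks : (size ks + q)%N = l -> uniq ks ->
  (P (Ev ks) = (n`!%:R^-1)%:E * \int[P]_t (A ks t *
    dsum (r ^~ t) [seq nb m | m <- iota (size ks) q] ks * E t))%E.
Proof.
elim: q ks => [|q ih] ks.
  rewrite addn0 => skl uks.
  have -> : Ev ks = [set t | N t = n /\ forall j : 'I_n, c j t = nth 0%N ks (b j)].
    apply/seteqP; split => t [Nt].
      by move=> h _; split => // j; rewrite h// skl.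
    move=> h; split => // j j'.
    by rewrite !h nth_uniq// ?skl.
  rewrite (assignment_prob model)//; congr (_ * _)%E.
  apply: eq_integral => t _ /=; rewrite mule1; congr (_%:E * _)%E.
  by apply: eq_bigl => j; rewrite skl bl.
move=> skl uks; have skl' : (size ks < l)%N by rewrite -skl -addn1 leq_add2l.
set m := size ks in skl skl' *.
have [j0 bj0] := bsurj skl'.
pose F k := if k \in ks then set0 else Ev (rcons ks k).
have mF k : measurable (F k) by rewrite /F; case: ifP.
have EvF : Ev ks = \bigcup_k F k.
  apply/seteqP; split => t.
    move=> [Nt ct bt]; exists (c j0 t) => //; rewrite /F ifN; last first.
      apply/negP => /(nthP 0%N)[i im ci].
      have [j bj] := bsurj (ltn_trans im skl').
      have := bt j j0; rewrite ct ?bj// ci eqxx bj0 => /esym/eqP im'.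
      by move: im; rewrite im' ltnn.
    split => // j; rewrite size_rcons ltnS leq_eqVlt nth_rcons -/m => /predU1P[bj|bj].
      by rewrite bj ltnn eqxx; apply/eqP; rewrite bt bj bj0.
    by rewrite bj; exact: ct.
  move=> [k _]; rewrite /F; case: ifPn => // kks [Nt ct bt]; split => // j bj.
  by rewrite ct ?size_rcons ?nth_rcons ?bj// ltnW.
have tF : trivIset setT F.
  apply/trivIsetP => k k' _ _ kk'; apply/seteqP; split => // t [].
  rewrite /F; case: ifPn => // kks [_ ct _]; case: ifPn => // kks' [_ ct' _].
  have := ct j0; rewrite ct' ?size_rcons bj0// !nth_rcons -/m ltnn eqxx.
  by move=> /(_ (ltnSn _)) k'k; move: kk'; rewrite k'k eqxx.
have PF : (P (\bigcup_k F k) = \sum_(k <oo) P (F k))%E.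
  by rewrite measure_bigcup//; apply: eq_eseriesl => k; rewrite in_setT.
rewrite EvF PF.
pose D k t := dsum (r ^~ t) [seq nb m | m <- iota m.+1 q] (rcons ks k).
have D_ge0 k t : (0 <= D k t)%E by exact: dsum_ge0.
have mD k : measurable_fun setT (D k) by apply: measurable_dsum.
pose f k t := (((k \notin ks)%:R * r k t ^+ nb m)%:E * D k t)%E.
have f_ge0 k t : (0 <= f k t)%E.
  by rewrite mule_ge0// lee_fin mulr_ge0// exprn_ge0.
have mf k : measurable_fun setT (f k).
  apply: emeasurable_funM => //; apply/measurable_EFinP.
  by apply: measurable_funM => //; exact: measurable_funX.
have AfE_ge0 k t : (0 <= A ks t * f k t * E t)%E.
  by apply: mule_ge0 => //; exact: mule_ge0.
transitivity (\sum_(k <oo) (n`!%:R^-1)%:E * \int[P]_t (A ks t * f k t * E t))%E.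
  apply: eq_eseriesr => k _; rewrite /F; case: ifPn => kks.
    rewrite measure0 (_ : (fun t => _) = cst 0%E) ?integral0 ?mule0//.
    by apply/funext => t; rewrite /f kks mul0r mul0e mule0 mul0e.
  rewrite ih ?size_rcons ?addSnnS// ?rcons_uniq ?kks//; congr (_ * _)%E.
  apply: eq_integral => t _; congr (_ * _)%E; rewrite /f kks mul1r muleA.
  congr (_ * _)%E; rewrite /A -EFinM; congr EFin.
  (* The newly revealed block contributes [nb m] equal factors [r k t]; the others are those of
     [A ks]. *)
  rewrite size_rcons -/m (bigID (fun j => b j == m))/= mulrC; congr (_ * _).
    apply: eq_big => [j|j /andP[bj bjm]]; first by rewrite ltnS ltn_neqAle andbC.
    by rewrite nth_rcons -/m ltn_neqAle bjm -ltnS bj.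
  rewrite (eq_bigl (fun j => j \in [pred j | b j == m])); last first.
    by move=> j; rewrite inE; case: eqVneq => [->|]; rewrite ?ltnSn ?andbF.
  rewrite (eq_bigr (fun=> r k t)); last first.
    by move=> j; rewrite inE nth_rcons -/m => /eqP ->; rewrite ltnn eqxx.
  by rewrite prodr_const.
rewrite -ge0_nneseriesZl; last first.
  by move=> k; apply: integral_ge0 => t _; exact: AfE_ge0.
congr (_ * _)%E; rewrite -integral_nneseries//; last first.
  by move=> k; apply: emeasurable_funM => //; exact: emeasurable_funM.
apply: eq_integral => t _; rewrite muleAC ge0_nneseriesZl; last first.
  by move=> k; exact: f_ge0.
by apply: eq_eseriesr => k _; rewrite muleAC.
Qed.

Lemma partition_prob :
  (P [set t | N t = n /\ forall j j' : 'I_n, (c j t == c j' t) = (b j == b j')] =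
   (n`!%:R^-1 * (\prod_(m < l) (gamma0 * tilted_moment rho (nb m)) *
     expR (- fine (texponent nu idfun))))%:E)%E.
Proof.
have nb0 m : (m < l)%N -> (0 < nb m)%N.
  by move=> /bsurj[j bj]; apply/card_gt0P; exists j; rewrite inE bj.
have -> : [set t | N t = n /\ forall j j' : 'I_n, (c j t == c j' t) = (b j == b j')] =
    Ev [::].
  by apply/seteqP; split => t []//= Nt h.
rewrite (@Ev_prob l)//=.
transitivity ((n`!%:R^-1)%:E * \int[P]_t (dsum (r ^~ t)
    [seq nb m | m <- iota 0 l] [::] * expeR (- \sum_(k <oo) (idfun (r k t))%:E)))%E.
  congr (_ * _)%E; apply: eq_integral => t _; congr (_ * _)%E.
  by rewrite /A big_pred0 ?mul1e.
rewrite (@expectation_dsum_expeRN _ _ _ _ (fun k t => r k t) nu)//; last first.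
- exact: tilt_id.
- apply/allP => _ /mapP[m + ->]; rewrite mem_iota => /andP[_ ml].
  exact: nb0.
rewrite -EFinM; congr (_ * (_ * _))%:E.
rewrite big_map (_ : iota 0 l = index_iota 0 l); last by rewrite /index_iota subn0.
rewrite big_mkord; apply: eq_bigr => m _.
by rewrite tmoment_crm_intensity// nb0.
Qed.

End partition_probability.

(** * Cluster labels *)

Section cluster_labels.
Variables (n : nat) (lab : {set {set 'I_n}} -> seq {set 'I_n}).
Hypothesis labP : is_labelling lab.
Variable i : 'I_n.
Implicit Types (f : 'I_n -> nat) (B : {set 'I_n}).

Let s f := lab (preim_partition f [set~ i]%SET).
Let meets f j B := [exists j' in B, f j' == f j].

Let labelE f j : cluster_label lab i f j = (find (meets f j) (s f)).+1.
Proof. by []. Qed.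

Let uniq_s f : uniq (s f).
Proof. by rewrite (perm_uniq (labP _)) enum_uniq. Qed.

Let mem_s f B : reflect (exists2 x, x != i & B = [set y in [set~ i] | f x == f y]%SET)
  (B \in s f).
Proof.
rewrite (perm_mem (labP _)) mem_enum; apply: (iffP imsetP).
  by move=> [x]; rewrite !inE => xi ->; exists x.
by move=> [x xi ->]; exists x; rewrite ?inE.
Qed.

Let block_const f B x y : B \in s f -> x \in B -> y \in B -> f x = f y.
Proof. by move=> /mem_s[z _ ->]; rewrite !inE => /andP[_ /eqP <-] /andP[_ /eqP]. Qed.

Let has_meets f j : j != i -> has (meets f j) (s f).
Proof.
move=> ji; apply/hasP; exists [set y in [set~ i] | f j == f y]%SET.
  by apply/mem_s; exists j.
by apply/existsP; exists j; rewrite !inE ji !eqxx.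
Qed.

(** Each block carries a single [f]-value, and [i] is the only element that can meet no block, so
    the extra label is not shared by distinct values. *)
Lemma cluster_label_eq f j j' :
  (cluster_label lab i f j == cluster_label lab i f j') = (f j == f j').
Proof.
apply/eqP/eqP => [|fjj']; last first.
  rewrite !labelE; congr (_.+1); apply: eq_find => B.
  by rewrite /meets fjj'.
rewrite !labelE => -[fE].
have [hj|hj] := boolP (has (meets f j) (s f)).
  have hj' : has (meets f j') (s f) by rewrite has_find -fE -has_find.
  have /existsP[y /andP[yB /eqP <-]] := nth_find finset.set0 hj.
  have /existsP[y' /andP[+ /eqP <-]] := nth_find finset.set0 hj'.
  rewrite -fE => y'B; apply: block_const yB y'B.
  by rewrite mem_nth// -has_find.
have hj' : ~~ has (meets f j') (s f) by rewrite has_find -fE -has_find.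
have ij a : ~~ has (meets f a) (s f) -> a = i.
  by apply: contraNeq => /has_meets.
by rewrite (ij j)// (ij j').
Qed.

Let label_le f j : j != i -> (cluster_label lab i f j <= size (s f))%N.
Proof. by move=> /(has_meets f); rewrite labelE has_find. Qed.

Let label_le_succ f j : (cluster_label lab i f j <= (size (s f)).+1)%N.
Proof. by rewrite labelE ltnS find_size. Qed.

Let label_surj f k : (0 < k <= size (s f))%N ->
  exists2 j, j != i & cluster_label lab i f j = k.
Proof.
case: k => // k /= ks; set B := nth finset.set0 (s f) k.
have Bs : B \in s f by rewrite mem_nth.
have /mem_s[x xi BE] := Bs; exists x => //; rewrite labelE; congr (_.+1).
have hx := has_meets f xi.
have xB : x \in B by rewrite BE !inE xi eqxx.
have /existsP[y /andP[yB' /eqP yx]] := nth_find finset.set0 hx.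
move: hx; rewrite has_find => hx.
have B's := mem_nth finset.set0 hx.
apply/eqP; rewrite -(nth_uniq finset.set0 hx ks (uniq_s f)) -/B BE.
have /mem_s[x' x'i B'E] := B's; rewrite B'E.
have x'y : f x' = f y by move: yB'; rewrite B'E !inE => /andP[_ /eqP].
by rewrite x'y yx.
Qed.

Lemma num_clustersE f zeta :
  (forall j, j != i -> cluster_label lab i f j = zeta j) ->
  num_clusters i zeta = size (s f).
Proof.
move=> fz; rewrite /num_clusters -[RHS](size_iota 1).
apply: perm_size; apply: uniq_perm; [exact: undup_uniq|exact: iota_uniq|].
move=> k; rewrite mem_undup mem_iota add1n ltnS; apply/mapP/idP => [[j]|].
  by rewrite mem_filter => /andP[ji _] ->; rewrite -fz// label_le.
move=> /label_surj[j ji <-]; exists j; first by rewrite mem_filter ji mem_enum.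
exact: fz.
Qed.

Lemma cluster_label_range f zeta j :
  (forall j, j != i -> cluster_label lab i f j = zeta j) ->
  j != i -> (0 < zeta j <= num_clusters i zeta)%N.
Proof. by move=> fz ji; rewrite (num_clustersE fz) -fz// label_le. Qed.

Lemma cluster_label_surj f zeta k :
  (forall j, j != i -> cluster_label lab i f j = zeta j) ->
  (0 < k <= num_clusters i zeta)%N -> exists2 j, j != i & zeta j = k.
Proof.
move=> fz; rewrite (num_clustersE fz) => /label_surj[j ji <-].
by exists j; rewrite ?fz.
Qed.

(** The labels of the other elements depend only on the partition they induce, not on the atom
    indices. *)
Lemma cluster_label_congr f f' :
  (forall j j', j != i -> j' != i -> (f j == f j') = (f' j == f' j')) ->
  forall j, j != i -> cluster_label lab i f j = cluster_label lab i f' j.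
Proof.
move=> ff' j ji; have sE : s f = s f'.
  congr lab; apply: eq_in_imset => x; rewrite !inE => xi.
  apply/setP => y; rewrite !inE; case: (boolP (y == i)) => //= yi.
  exact: ff'.
rewrite !labelE -sE; congr (_.+1); apply: eq_in_find => B /mem_s[x _ ->].
apply: eq_existsb => y; rewrite !inE; case: (boolP (y == i)) => //= yi.
by rewrite (ff' y j).
Qed.

Lemma new_cluster_label f : (forall j, j != i -> f i != f j) ->
  cluster_label lab i f i = (size (s f)).+1.
Proof.
move=> fi; apply/eqP; rewrite eqn_leq label_le_succ ltnNge.
apply/negP => lei; have [|j ji /eqP] := @label_surj f (cluster_label lab i f i).
  by rewrite lei.
by rewrite cluster_label_eq eq_sym (negbTE (fi j ji)).
Qed.

(** Translates a label event into a partition event. [f0] witnesses that [zeta] is attainable; the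
    predecessors pass from labels starting at 1 to blocks numbered from 0. *)
Lemma cluster_labels_kernel f f0 zeta k :
  (forall j, j != i -> cluster_label lab i f0 j = zeta j) ->
  (0 < k <= (num_clusters i zeta).+1)%N ->
  ((forall j, j != i -> cluster_label lab i f j = zeta j) /\
     cluster_label lab i f i = k) <->
  (forall j j', (f j == f j') =
     ((if j == i then k else zeta j).-1 == (if j' == i then k else zeta j').-1)).
Proof.
move=> f0z k0l; pose b j := (if j == i then k else zeta j).
have b_gt0 j : (0 < b j)%N.
  rewrite /b; case: eqP => [_|/eqP ji]; first by case/andP: k0l.
  by case/andP: (cluster_label_range f0z ji).
have pred_b j j' : ((b j).-1 == (b j').-1) = (b j == b j').
  by rewrite -eqSS !prednK.
split=> [[fz fi] j j'|fb].
  rewrite -/(b j) -/(b j') pred_b -cluster_label_eq.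
  have bE a : cluster_label lab i f a = b a.
    by rewrite /b; case: eqVneq => [->|/fz].
  by rewrite !bE.
have {}fb j j' : (f j == f j') = (b j == b j') by rewrite fb pred_b.
have fz j : j != i -> cluster_label lab i f j = zeta j.
  move=> ji; rewrite -f0z//; apply: cluster_label_congr => // a a' ai a'i.
  by rewrite fb /b (negbTE ai) (negbTE a'i) -!f0z// cluster_label_eq.
(* An existing label [k] is carried by some [j] other than [i], with which [i] agrees; otherwise [i]
   differs from everyone and gets the extra label. *)
split => //; have [kl|kl] := leqP k (num_clusters i zeta).
  have [|j ji zj] := @cluster_label_surj f0 zeta k f0z.
    by rewrite kl andbT; case/andP: k0l.
  rewrite -zj -fz//; apply/eqP.
  by rewrite cluster_label_eq fb /b eqxx (negbTE ji) zj.
rewrite new_cluster_label; last first.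
  move=> j ji; rewrite fb /b eqxx (negbTE ji) gtn_eqF//.
  by case/andP: (cluster_label_range f0z ji) => _ /leq_ltn_trans; apply.
rewrite -(num_clustersE fz); apply/eqP; rewrite eqn_leq kl /=.
by case/andP: k0l.
Qed.

End cluster_labels.

(** The integrand is positive on []0, +oo[], so a zero integral would make that set negligible.
    Finiteness is also needed, since [fine] sends [+oo] to 0. *)
Lemma tilted_moment_gt0 (R : realType) (rho : {measure set R -> \bar R}) (m : nat) :
  rho `]0, +oo[%classic != 0%E ->
  (\int[rho]_(s in `]0%R, +oo[) (1 - expR (- s))%:E < +oo)%E ->
  (0 < m)%N -> 0 < tilted_moment rho m.
Proof.
move=> rho0 rho_int m0; pose D : set R := `]0, +oo[%classic.
have mD : measurable D by exact: measurable_itv.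
pose f (s : R) := (s ^+ m * expR (- s))%:E.
have mf : measurable_fun D f.
  by apply: (@measurable_tmoment _ idfun); exact: measurable_id.
have f_gt0 s : D s -> (0 < f s)%E.
  by rewrite /D /= in_itv/= andbT => s0; rewrite lte_fin mulr_gt0 ?expR_gt0// exprn_gt0.
have ffin : (\int[rho]_(s in D) f s < +oo)%E.
  exact: (tmoment_lty rho_int (tilt_id rho_int) m0).
apply: fine_gt0; rewrite ffin andbT lt_neqAle; apply/andP; split; last first.
  by apply: integral_ge0 => s /f_gt0/ltW.
apply/negP => /eqP/esym int0.
have /(ae_eq_integral_abs rho mD mf) : (\int[rho]_(s in D) `|f s|)%E = 0%E.
  rewrite -[RHS]int0; apply: eq_integral => s /set_mem/f_gt0/ltW s0.
  by rewrite gee0_abs.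
move=> [A [mA A0 DA]]; move/eqP: rho0; apply.
apply/eqP; rewrite -measure_le0 -A0; apply: le_measure; rewrite ?inE//.
by move=> s Ds; apply: DA => /= /(_ Ds) fs0; have := f_gt0 s Ds; rewrite fs0 ltxx.
Qed.

Theorem corollary3 (R : realType) (Om : completeMetricType R)
  (sepOm : separable Om)
  (G0 : {finite_measure set (borelType Om) -> \bar R})
  (G0_gt0 : (0 < G0 setT)%E)
  (rho : {measure set R -> \bar R})
  (rho_supp : rho `]-oo, 0]%classic = 0%E)
  (rho_neq0 : rho `]0, +oo[%classic != 0%E)
  (rho_int : (\int[rho]_(s in `]0%R, +oo[) (1 - expR (- s))%:E < +oo)%E)
  (d : measure_display) (T : measurableType d) (P : probability T R)
  (r : nat -> {RV P >-> R}) (w : nat -> {RV P >-> borelType Om})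
  (size : {RV P >-> nat}) (c : nat -> {RV P >-> nat})
  (model : crm_mixed_poisson r w size c rho G0)
  (n : nat) (i : 'I_n)
  (lab : {set {set 'I_n}} -> seq {set 'I_n}) (labP : is_labelling lab)
  (zeta : 'I_n -> nat) :
  let gamma0 := fine (G0 setT) in
  let z (j : 'I_n) (t : T) :=
    cluster_label lab i (fun j' : 'I_n => c j' t) j in
  let given := [set t | size t = n /\ forall j, j != i -> z j t = zeta j] in
  let l := num_clusters i zeta in
  (0 < P given)%E ->
  exists2 C : R, 0 < C & forall k : nat, (1 <= k <= l.+1)%N ->
    cond_prob P [set t | z i t = k] given =
    C * (if (k <= l)%N
         then tilted_moment rho (cluster_size i zeta k).+1 /
              tilted_moment rho (cluster_size i zeta k)
         else gamma0 * tilted_moment rho 1).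
Proof.
move=> gamma0 z given l given_gt0.
have n0 : (0 < n)%N by apply: leq_ltn_trans (ltn_ord i).
have gamma0_gt0 : 0 < gamma0.
  by apply: fine_gt0; rewrite G0_gt0 -ge0_fin_numE ?fin_num_measure.
have tm_gt0 m : (0 < m)%N -> 0 < tilted_moment rho m.
  exact: tilted_moment_gt0.
have given_fin : P given \is a fin_num.
  apply: fin_num_measure.
  rewrite (_ : given = (size @^-1` [set n]) `&` [set t | (forall j, j != i -> z j t = zeta j)])//.
  apply: measurableI; first exact: measurable_funPTI.
  exact: (measurable_labels c (fun a : 'I_n -> nat =>
    forall j, j != i -> cluster_label lab i a j = zeta j)).
have Pgiven_gt0 : 0 < fine (P given) by apply: fine_gt0; rewrite given_gt0 ltey_eq given_fin.
(* A sample point of [given] supplies the assignment that realises [zeta], whence its values are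
   exactly the labels from 1 to [l]. *)
have [t0 [_ f0z]] : given !=set0.
  by apply/set0P/eqP => given0; move: given_gt0; rewrite given0 measure0 ltxx.
set f0 := fun j' : 'I_n => c j' t0 in f0z.
have {}f0z j : j != i -> cluster_label lab i f0 j = zeta j by exact: f0z.
have zeta_rg j : j != i -> (0 < zeta j <= l)%N := cluster_label_range labP f0z.
pose cs := cluster_size i zeta.
have cs_gt0 m : (m < l)%N -> (0 < cs m.+1)%N.
  move=> ml; have [|j ji zj] := @cluster_label_surj _ _ labP i f0 zeta m.+1 f0z.
    by rewrite ml.
  by rewrite /cs /cluster_size (bigD1 j)//= zj eqxx.
pose E : R := expR (- fine (texponent (crm_intensity rho G0) idfun)).
pose Pi : R := \prod_(m < l) (gamma0 * tilted_moment rho (cs m.+1)).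
have Pi_gt0 : 0 < Pi.
  by apply: prodr_gt0 => m _; rewrite mulr_gt0// tm_gt0// cs_gt0.
(* [Pi] is the product over the clusters of [zeta] without [i]; placing [i] multiplies it by the
   factor in the claim. *)
exists (n`!%:R^-1 * (Pi * E) / fine (P given)).
  by rewrite divr_gt0// mulr_gt0 ?invr_gt0 ?ltr0n ?fact_gt0// mulr_gt0// expR_gt0.
move=> k kl; pose b j := (if j == i then k else zeta j).-1.
(* The number of blocks once [i] is placed: [l] if it joins a cluster, [l.+1] if it opens one. *)
pose L := maxn l k.
have b_lt j : (b j < L)%N.
  rewrite /b /L; case: eqP => [_|/eqP ji].
    by case: k kl {b L} => // k _; rewrite leq_max leqnn orbT.
  case: (zeta j) (zeta_rg j ji) => // q /= ql.
  by rewrite leq_max ql.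
have b_surj m : (m < L)%N -> exists j, b j = m.
  rewrite /L leq_max => /orP[ml|mk].
    have [|j ji zj] := @cluster_label_surj _ _ labP i f0 zeta m.+1 f0z.
      by rewrite ml.
    by exists j; rewrite /b (negbTE ji) zj.
  have [ml|lm] := ltnP m l.
    have [|j ji zj] := @cluster_label_surj _ _ labP i f0 zeta m.+1 f0z.
      by rewrite ml.
    by exists j; rewrite /b (negbTE ji) zj.
  exists i; rewrite /b eqxx; case: k kl mk {b L b_lt} => // k.
  rewrite !ltnS => /andP[_ kl] mk; apply/eqP.
  by rewrite eqn_leq mk (leq_trans kl lm).
have nbE m : #|[pred j | b j == m]| = ((k == m.+1) + cs m.+1)%N.
  rewrite -sum1_card big_mkcond (bigD1 i)//=; congr (_ + _)%N.
    by rewrite inE /b eqxx; case: k kl {b L b_lt b_surj}.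
  rewrite /cs /cluster_size; apply: eq_bigr => j ji; rewrite inE /b (negbTE ji).
  by case: (zeta j) (zeta_rg j ji) => // q _; case: (q == m).
have evE : [set t | z i t = k] `&` given = [set t | size t = n /\
    forall j j' : 'I_n, (c j t == c j' t) = (b j == b j')].
  apply/seteqP; split => t.
    move=> [zi [sz zj]]; split => //.
    exact: ((cluster_labels_kernel labP (fun j' : 'I_n => c j' t) f0z kl).1 (conj zj zi)).
  move=> [sz h].
  by have [zj zi] := (cluster_labels_kernel labP (fun j' : 'I_n => c j' t) f0z kl).2 h.
rewrite /cond_prob evE (partition_prob model rho_int n0 b_lt b_surj)/=.
rewrite -/E; under eq_bigr do rewrite nbE.
suff -> : \prod_(m < L) (gamma0 * tilted_moment rho ((k == m.+1) + cs m.+1)) =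
    Pi * (if (k <= l)%N then tilted_moment rho (cs k).+1 / tilted_moment rho (cs k)
          else gamma0 * tilted_moment rho 1).
  by rewrite -/(cs k); move: (if _ then _ else _) => X; ring.
(* Joining cluster [k] raises the order of one moment by 1, and the factors [gamma0] cancel. A new
   cluster adds a last factor of order 1, because no other element has label [l.+1]. *)
case: ifPn => [kl'|].
  case: k kl kl' {b b_lt b_surj nbE evE} @L => // k _ kl L.
  rewrite /L (maxn_idPl kl) /Pi (bigD1 (Ordinal kl))//= [in RHS](bigD1 (Ordinal kl))//=.
  rewrite eqxx add1n; under eq_bigr => m mk.
    rewrite eqSS eq_sym (_ : (m == k :> nat) = false) ?add0n; last exact: negbTE.
    over.
  by field; rewrite gt_eqF// tm_gt0// cs_gt0.
rewrite -ltnNge => lk; have kE : k = l.+1.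
  by apply/eqP; rewrite eqn_leq lk andbT; case/andP: kl.
rewrite /L (maxn_idPr (ltnW lk)) kE big_ord_recr/= eqxx.
have -> : cs l.+1 = 0%N.
  rewrite /cs /cluster_size big1// => j /zeta_rg/andP[_ zl].
  by rewrite ltn_eqF.
congr (_ * _); apply: eq_bigr => m _.
by rewrite eqSS gtn_eqF// add0n.
Qed.
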